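(* Assume that $f,g$ satisfy the regularity condition and the dissipativity condition stated in the context, and let $R>0$. Then for any $T\ge0$ and $\epsilon_7>0$ there exists a constant $H>0$ such that for every step size $\Delta=\tau/M$, every $k\in\mathbb{N}$ and every $\xi\in B(R)$, $$\mathbb{P}\big\{\|X_s^{0,\xi}\|\le H\ \text{ for all } s\in[t_k,t_k+T]\big\}\ge1-\epsilon_7.$$
   Context: Setting. $|\cdot|$ is the Euclidean norm on $\mathbb{R}^d$ and the trace norm on $\mathbb{R}^{d\times m}$. Let $\tau>0$, $\mathcal{C}=C([-\tau,0];\mathbb{R}^d)$ with supremum norm $\|X\|=\sup_{-\tau\le\theta\le0}|X(\theta)|$, and $B(R)=\{X\in\mathcal{C}:\|X\|\le R\}$ for $R>0$. $W$ is an $m$-dimensional Brownian motion on a filtered probability space $(\Omega,\mathcal{F},\mathbb{P})$ with the usual conditions. $f:\mathbb{R}^d\times\mathbb{R}^d\to\mathbb{R}^d$ and $g:\mathbb{R}^d\times\mathbb{R}^d\to\mathbb{R}^{d\times m}$ are Borel measurable. Regularity condition. There are constants $q\ge2$ and $a_1,\dots,a_9,\epsilon_1,\epsilon_2\ge0$, and functions $g_1,g_2:\mathbb{R}^d\to\mathbb{R}^{d\times m}$ such that, with $V(x,y)=|x-y|^2(|x|^{q-1}+|y|^{q-1})$, for all $x,\bar x,y,\bar y\in\mathbb{R}^d$: $|f(x,y)-f(\bar x,\bar y)|\le a_1(1+|x|^{q-1}+|\bar x|^{q-1}+|y|^{q-1}+|\bar y|^{q-1})(|x-\bar x|+|y-\bar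 y|)$; $|g(x,y)-g(\bar x,\bar y)|^2\le\epsilon_1|g_1(x)-g_1(\bar x)|^2+\epsilon_2|g_2(y)-g_2(\bar y)|^2$; $\epsilon_1|g_1(x)-g_1(\bar x)|^2\le a_2|x-\bar x|^2+a_4V(x,\bar x)$; $\epsilon_2|g_2(y)-g_2(\bar y)|^2\le a_3|y-\bar y|^2+a_5V(y,\bar y)$; $|f(x,y)|\le a_6(1+|x|^q+|y|^q)$; $|g(x,y)|^2\le a_7+a_8|x|^{q+1}+a_9|y|^{q+1}$. Dissipativity condition. With the same $q,a_i,V$ and $p^*=4q-2$, there are nonnegative constants $b_1,\dots,b_{13},l_1,l_2$ with $b_1>b_2+l_1(a_2+a_3)$, $b_3>l_1(a_4+a_5)$, $b_5>b_6$, $b_7>b_8$, $b_{10}>b_{11}$, $b_{12}>b_{13}$, $l_1>2$, $l_2>1$, such that for all $x,\bar x,y,\bar y\in\mathbb{R}^d$: $2\langle x-\bar x,f(x,y)-f(\bar x,\bar y)\rangle\le-b_1|x-\bar x|^2+b_2|y-\bar y|^2-b_3V(x,\bar x)$; $\frac{p^*}{2}|x|^{p^*-2}\big(2\langle x,f(x,y)\rangle+(p^*-1)|g(x,y)|^2\big)\le b_4-b_5|x|^{p^*}+b_6|y|^{p^*}-b_7|x|^{p^*+q-1}+b_8|y|^{p^*+q-1}$; $2\langle x,f(x,y)\rangle+l_2|g(x,y)|^2\le b_9-b_{10}|x|^2+b_{11}|y|^2-b_{12}|x|^{q+1}+b_{13}|y|^{q+1}$. Backward Euler-Maruyama (BEM)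 method. Step sizes are $\Delta=\tau/M$ with $M$ a positive integer, $t_k=k\Delta$ for $k\ge-M$. Put $X_k=\xi(t_k)$ for $k=-M,\dots,0$ and, for $k\ge1$, $X_k=X_{k-1}+f(X_k,X_{k-M})\Delta+g(X_{k-1},X_{k-M-1})\Delta W_{k-1}$, where $\Delta W_{k-1}=W(k\Delta)-W((k-1)\Delta)$ (this implicit scheme is well defined). The continuous approximation is $X(t)=X(t;0,\xi)=\xi(t)$ for $t\in[-\tau,0]$ and $X(t)=X_k+\theta(X_{k+1}-X_k)$ for $t\ge0$, with $k=\lfloor t/\Delta\rfloor$, $\theta=t/\Delta-k$. The numerical segment at time $t\ge0$ is $X_t^{0,\xi}=\{X(t+\theta;0,\xi):-\tau\le\theta\le0\}\in\mathcal{C}$. *)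

(* Defs.v *)
From HB Require Import structures.
From mathcomp Require Import all_boot all_order all_algebra.
From mathcomp Require Import all_classical all_reals all_analysis.

Set Implicit Arguments.
Unset Strict Implicit.
Unset Printing Implicit Defensive.

Import Order.TTheory GRing.Theory Num.Theory.
Import numFieldNormedType.Exports.

Local Open Scope classical_set_scope.
Local Open Scope ring_scope.

(* R^d is 'cV[R]_d.  The library norm `|x| on matrices is the max norm, hence
   the explicit Euclidean and trace norms below; the matrix topology of the
   library is the Euclidean topology. *)

Definition dotv (R : realType) (d : nat) (x y : 'cV[R]_d) : R :=
  \sum_(i < d) x i 0 * y i 0.

Definition enorm (R : realType) (d : nat) (x : 'cV[R]_d) : R :=
  Num.sqrt (dotv x x).

Definition trnorm (R : realType) (d m : nat) (A : 'M[R]_(d, m)) : R :=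
  Num.sqrt (\tr (A^T *m A)).

Definition borel (T : topologicalType) : set (set T) := <<s @open T >>.

Definition borel_fun (S T : topologicalType) (h : S -> T) : Prop :=
  forall B, borel B -> borel (h @^-1` B).

(* Elements of C([-tau,0]; R^d) are represented by total functions R -> R^d, of
   which only the restriction to [-tau,0] matters. *)

Definition supnorm (R : realType) (d : nat) (tau : R)
    (phi : R -> 'cV[R]_d) : R :=
  sup [set enorm (phi u) | u in `[- tau, 0]].

Definition in_C (R : realType) (d : nat) (tau : R)
    (phi : R -> 'cV[R]_d) : Prop :=
  {within `[- tau, 0], continuous phi}.

Definition in_ball (R : realType) (d : nat) (tau rad : R)
    (phi : R -> 'cV[R]_d) : Prop :=
  in_C tau phi /\ supnorm tau phi <= rad.

(* Time runs over [0,+oo[: values at negative times are irrelevant. *)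
Record filtration_usual (R : realType) (disp : measure_display)
    (Omega : measurableType disp) (P : probability Omega R)
    (F : R -> set (set Omega)) : Prop := {
  filtration_sigma : forall t, 0 <= t -> sigma_algebra setT (F t);
  filtration_measurable : forall t, 0 <= t -> F t `<=` measurable;
  filtration_mono : forall s t, 0 <= s -> s <= t -> F s `<=` F t;
  filtration_right_continuous : forall t, 0 <= t ->
    F t = \bigcap_(s in [set s | t < s]) F s;
  filtration_complete : forall N, P.-negligible N -> F 0 N
}.

(* The last two fields say that W t - W s is independent of F s with law
   N(0, (t - s) I_m), the product of m copies of N(0, t - s).  The second
   parameter of normal_prob is the standard deviation. *)
Record brownian_motion (R : realType) (disp : measure_display)
    (Omega : measurableType disp) (P : probability Omega R)
    (F : R -> set (set Omega)) (m : nat)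
    (W : R -> Omega -> 'cV[R]_m) : Prop := {
  brownian_adapted : forall t (B : set 'cV[R]_m),
    0 <= t -> borel B -> F t (W t @^-1` B);
  brownian_init : {ae P, forall w, W 0 w = 0};
  brownian_continuous :
    {ae P, forall w, {within `[0, +oo[, continuous (fun t => W t w)}};
  brownian_indep : forall s t A (B : set 'cV[R]_m),
    0 <= s -> s < t -> F s A -> borel B ->
    P (A `&` [set w | B (W t w - W s w)%R])
      = (P A * P [set w | B (W t w - W s w)%R])%E;
  brownian_normal : forall s t (B : 'I_m -> set R), 0 <= s -> s < t ->
    (forall i, measurable (B i)) ->
    P [set w | forall i, B i ((W t w - W s w) i 0)]
      = (\prod_(i < m) normal_prob 0 (Num.sqrt (t - s)) (B i))%E
}.

Definition V (R : realType) (d : nat) (q : R) (x y : 'cV[R]_d) : R :=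
  enorm (x - y) ^+ 2 * (enorm x `^ (q - 1) + enorm y `^ (q - 1)).

Record regularity (R : realType) (d m : nat)
    (f : 'cV[R]_d -> 'cV[R]_d -> 'cV[R]_d)
    (g : 'cV[R]_d -> 'cV[R]_d -> 'M[R]_(d, m))
    (q a1 a2 a3 a4 a5 a6 a7 a8 a9 eps1 eps2 : R)
    (g1 g2 : 'cV[R]_d -> 'M[R]_(d, m)) : Prop := {
  reg_q : 2 <= q;
  reg_a : [/\ 0 <= a1, 0 <= a2, 0 <= a3, 0 <= a4 & 0 <= a5]
       /\ [/\ 0 <= a6, 0 <= a7, 0 <= a8 & 0 <= a9];
  reg_eps : 0 <= eps1 /\ 0 <= eps2;
  reg_f_lip : forall x x' y y',
    enorm (f x y - f x' y')
      <= a1 * (1 + enorm x `^ (q - 1) + enorm x' `^ (q - 1)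
                 + enorm y `^ (q - 1) + enorm y' `^ (q - 1))
            * (enorm (x - x') + enorm (y - y'));
  reg_g_lip : forall x x' y y',
    trnorm (g x y - g x' y') ^+ 2
      <= eps1 * trnorm (g1 x - g1 x') ^+ 2
         + eps2 * trnorm (g2 y - g2 y') ^+ 2;
  reg_g1 : forall x x',
    eps1 * trnorm (g1 x - g1 x') ^+ 2
      <= a2 * enorm (x - x') ^+ 2 + a4 * V q x x';
  reg_g2 : forall y y',
    eps2 * trnorm (g2 y - g2 y') ^+ 2
      <= a3 * enorm (y - y') ^+ 2 + a5 * V q y y';
  reg_f_growth : forall x y,
    enorm (f x y) <= a6 * (1 + enorm x `^ q + enorm y `^ q);
  reg_g_growth : forall x y,
    trnorm (g x y) ^+ 2
      <= a7 + a8 * enorm x `^ (q + 1) + a9 * enorm y `^ (q + 1)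
}.

Definition pstar (R : realType) (q : R) : R := 4 * q - 2.

Record dissipativity (R : realType) (d m : nat)
    (f : 'cV[R]_d -> 'cV[R]_d -> 'cV[R]_d)
    (g : 'cV[R]_d -> 'cV[R]_d -> 'M[R]_(d, m))
    (q a2 a3 a4 a5 : R)
    (b1 b2 b3 b4 b5 b6 b7 b8 b9 b10 b11 b12 b13 l1 l2 : R) : Prop := {
  diss_b : [/\ 0 <= b1, 0 <= b2, 0 <= b3, 0 <= b4 & 0 <= b5]
        /\ [/\ 0 <= b6, 0 <= b7, 0 <= b8, 0 <= b9 & 0 <= b10]
        /\ [/\ 0 <= b11, 0 <= b12 & 0 <= b13];
  diss_l : 2 < l1 /\ 1 < l2;
  diss_b1 : b2 + l1 * (a2 + a3) < b1;
  diss_b3 : l1 * (a4 + a5) < b3;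
  diss_b5 : b6 < b5;
  diss_b7 : b8 < b7;
  diss_b10 : b11 < b10;
  diss_b12 : b13 < b12;
  diss_diff : forall x x' y y',
    2 * dotv (x - x') (f x y - f x' y')
      <= - b1 * enorm (x - x') ^+ 2 + b2 * enorm (y - y') ^+ 2
         - b3 * V q x x';
  diss_pstar : forall x y,
    pstar q / 2 * enorm x `^ (pstar q - 2)
        * (2 * dotv x (f x y) + (pstar q - 1) * trnorm (g x y) ^+ 2)
      <= b4 - b5 * enorm x `^ pstar q + b6 * enorm y `^ pstar q
            - b7 * enorm x `^ (pstar q + q - 1)
            + b8 * enorm y `^ (pstar q + q - 1);
  diss_growth : forall x y,
    2 * dotv x (f x y) + l2 * trnorm (g x y) ^+ 2
      <= b9 - b10 * enorm x ^+ 2 + b11 * enorm y ^+ 2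
            - b12 * enorm x `^ (q + 1) + b13 * enorm y `^ (q + 1)
}.

Definition stepsize (R : realType) (tau : R) (M : nat) : R := tau / M%:R.

Definition gridpt (R : realType) (tau : R) (M : nat) (k : int) : R :=
  k%:~R * stepsize tau M.

(* X k is the numerical solution at time k tau / M, for k >= -M.  The scheme is
   implicit, so it is given as a relation; under the dissipativity and
   regularity conditions it has exactly one solution (up to the irrelevant
   indices k < -M), because x |-> x - Delta f(x,y) is continuous and strongly
   monotone. *)
Record bem_scheme (R : realType) (d m : nat) (Omega : Type) (tau : R)
    (f : 'cV[R]_d -> 'cV[R]_d -> 'cV[R]_d)
    (g : 'cV[R]_d -> 'cV[R]_d -> 'M[R]_(d, m))
    (W : R -> Omega -> 'cV[R]_m) (M : nat) (xi : R -> 'cV[R]_d)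
    (X : int -> Omega -> 'cV[R]_d) : Prop := {
  bem_init : forall (k : int) w, - M%:Z <= k <= 0 ->
    X k w = xi (gridpt tau M k);
  bem_step : forall (k : int) w, 1 <= k ->
    X k w = X (k - 1) w
      + stepsize tau M *: f (X k w) (X (k - M%:Z) w)
      + g (X (k - 1) w) (X (k - M%:Z - 1) w)
          *m (W (gridpt tau M k) w - W (gridpt tau M (k - 1)) w)
}.

Definition bem_path (R : realType) (d : nat) (Omega : Type) (tau : R)
    (M : nat) (xi : R -> 'cV[R]_d) (X : int -> Omega -> 'cV[R]_d)
    (w : Omega) (t : R) : 'cV[R]_d :=
  if t <= 0 then xi t
  else let k := Num.floor (t / stepsize tau M) in
       let theta := t / stepsize tau M - k%:~R in
       X k w + theta *: (X (k + 1) w - X k w).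

Definition segment (R : realType) (d : nat) (x : R -> 'cV[R]_d) (t : R)
  : R -> 'cV[R]_d := fun u => x (t + u).

(* Main.v *)
Require Import Defs.
From HB Require Import structures.
From mathcomp Require Import all_boot all_order all_algebra.
From mathcomp Require Import all_classical all_reals all_analysis.
From mathcomp Require Import measurable_realfun ring lra.
Import Order.TTheory GRing.Theory Num.Theory.
Import numFieldNormedType.Exports.
Local Open Scope classical_set_scope.
Local Open Scope ring_scope.

(** The proof is an energy estimate for a Lyapunov functional, followed by a
    maximal inequality for nonnegative almost supermartingales.

    Write [D] for the step, [X_n] for the solution at time [n D] and [g_n] for
    the diffusion coefficient at step [n].  Testing the implicit equation with
    [X_(n+1)] (lemma [implicit_euler_energy]) gives
      [|X_(n+1)|^2 <= |X_n|^2 + 2 D <X_(n+1), f> + 2 <X_n, g_n dW> + |g_n dW|^2].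
    The terms containing the increment [dW], once compensated by [D |g_n|^2],
    have zero integral over every event of the past ([integral_noise]); the
    compensator is absorbed by carrying [D |g_n|^2] in the functional, since the
    dissipativity condition controls [2 <x, f> + l2 |g|^2] with [l2 > 1].  What
    remains are the delayed terms [b11 |y|^2 + b13 |y|^(q+1)], dominated by the
    instantaneous ones because [b11 < b10] and [b13 < b12].  They are stored in a
    discounted sum over one delay interval, whose weights are powers of
    [rho = 1 + lam D]; as [rho^M] is at most [exp (lam tau)] for every [M], one
    small [lam > 0] works for all step sizes ([discount_rate]).  The resulting
    functional [U] satisfies
      [rho U_(n+1) <= U_n + D b9 + (centred noise)]
    pathwise ([lyapunov_noise_step]), and it dominates [|X_n|^2].

    Two consequences follow, both uniform in the step size.  Taking
    expectations, [E U_n] never exceeds the larger of the bound on [U_0] and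
    [b9 / lam] ([dissipative_expectation]).  Stopping [U] at its first passage
    above a level [l] gives, as for Ville's inequality, that
    [l P (U > l somewhere in k .. k + N) <= K + D b9 N],
    where [K] is the bound on the expectations ([dissipative_maximal]).  On the
    time window of the theorem [D N] is at most [T + 2 tau], so that a level
    independent of [k], of [D] and of the initial segment in the ball makes the
    probability as small as wanted.

    Since the interpolated path runs along the segments joining grid values, a
    bound on the grid values is a bound on all numerical segments
    ([bem_path_le], [segment_event]).  Finally the event of the theorem has to be
    measurable: the implicit step is a Lipschitz function of its data
    ([implicit_euler_stability]), and exceeding the bound at some time is stable
    under small perturbations of finitely many grid values, so that both
    measurability claims reduce to [measurable_open_dependence]. *)

(** * Moments of the normal law *)

Section density.
Import HBNNSimple.

(** The identity holds for simple functions by the hypothesis on measures of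
    sets, and passes to nonnegative functions by monotone convergence. *)
Lemma ge0_integral_density {d} {T : measurableType d} {R : realType}
    (mu nu : {measure set T -> \bar R}) (p : T -> R)
    (mp : measurable_fun setT p) (p0 : forall x, 0 <= p x)
    (nuE : forall A, measurable A ->
      nu A = (\int[mu]_(x in A) (p x)%:E)%E)
    (f : T -> R) (mf : measurable_fun setT f) (f0 : forall x, 0 <= f x) :
  (\int[nu]_x (f x)%:E = \int[mu]_x (f x * p x)%:E)%E.
Proof.
have mF : measurable_fun setT (fun x => (f x)%:E) by exact/measurable_EFinP.
pose h := nnsfun_approx measurableT mF.
have mh n : measurable_fun setT (h n) by exact: measurable_funPT.
have cvgh x : (EFin \o h n) x @[n --> \oo] --> (f x)%:E.
  by apply: (cvg_nnsfun_approx measurableT mF) => // y _; rewrite lee_fin.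
have -> : (\int[nu]_x (f x)%:E =
    limn (fun n => \int[nu]_x (EFin \o h n) x))%E.
  rewrite -monotone_convergence//.
  - by apply: eq_integral => x _; apply/esym/cvg_lim => //; exact: cvgh.
  - by move=> n; exact/measurable_EFinP.
  - by move=> n x _ /=; rewrite lee_fin.
  - by move=> x _ a b ab; rewrite lee_fin; exact/lefP/nd_nnsfun_approx.
have -> : (\int[mu]_x (f x * p x)%:E =
    limn (fun n => \int[mu]_x ((h n x) * p x)%:E))%E.
  rewrite -monotone_convergence//.
  - apply: eq_integral => x _; apply/esym/cvg_lim => //.
    under eq_fun do rewrite EFinM.
    rewrite EFinM; apply: cvgeZr => //; exact: cvgh.
  - by move=> n; apply/measurable_EFinP; exact: measurable_funM.
  - by move=> n x _ /=; rewrite lee_fin mulr_ge0.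
  - move=> x _ a b ab; rewrite lee_fin ler_wpM2r//.
    by exact/lefP/nd_nnsfun_approx.
apply/congr_lim/funext => n.
transitivity (\int[nu]_x
   (\sum_(y \in range (h n)) (y * \1_(h n @^-1` [set y]) x)%:E))%E.
  by apply: eq_integral => t _ /=; rewrite fimfunE -fsumEFin.
have mind r : measurable (h n @^-1` [set r]) by [].
have indich r : measurable_fun setT (fun x => (r * \1_(h n @^-1` [set r]) x)%:E).
  by apply/measurable_EFinP/measurable_funM.
rewrite ge0_integral_fsum//; last first.
  by move=> m y Ey; rewrite EFinM; exact: nnfun_muleindic_ge0.
transitivity (\int[mu]_x (\sum_(y \in range (h n))
    ((y * \1_(h n @^-1` [set y]) x)%:E * (p x)%:E)))%E; last first.
  apply: eq_integral => x _.
  rewrite -ge0_mule_fsuml => [|y]; last by rewrite EFinM; exact: nnfun_muleindic_ge0.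
  by rewrite fsumEFin // -(fimfunE _ x) EFinM.
rewrite ge0_integral_fsum//; last 2 first.
  - by move=> y; apply: emeasurable_funM => //; exact/measurable_EFinP.
  - by move=> m y Ey; rewrite mule_ge0// ?lee_fin// -lee_fin EFinM nnfun_muleindic_ge0.
apply: eq_fsbigr => r; rewrite inE => -[t _ <-].
under eq_integral do rewrite EFinM.
under [RHS]eq_integral do rewrite EFinM -muleA.
rewrite ge0_integralZl//; last 2 first.
  - exact/measurable_EFinP.
  - by rewrite lee_fin.
rewrite ge0_integralZl//; last 3 first.
  - by apply: emeasurable_funM; exact/measurable_EFinP.
  - by move=> x _; rewrite mule_ge0 ?lee_fin.
  - by rewrite lee_fin.
congr (_ * _)%E.
rewrite integral_indic// setIT nuE// integral_mkcond.
by apply: eq_integral => x _; rewrite epatch_indic muleC.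
Qed.

End density.

Section normal_moments.
Context {R : realType} (s : R) (s0 : 0 < s).
Local Notation mu := (@lebesgue_measure R).
Local Notation phi := (normal_pdf 0 s).

Let s_neq0 : s != 0. Proof. by rewrite gt_eqF. Qed.

Lemma is_derive_normal_pdf x :
  is_derive x (1 : R) phi (- (x / s ^+ 2) * phi x).
Proof.
have -> : phi = (fun x => normal_peak s * expR (- (2 * s ^+ 2)^-1 * x ^+ 2)).
  by apply/funext => y; rewrite normal_pdfE// /normal_fun subr0 mulNr
    -mulr_natl; congr (_ * expR _); rewrite mulrC mulNr.
set c := normal_peak s; set k := (2 * s ^+ 2)^-1.
apply: is_derive_eq.
rewrite /GRing.scale /= mulr1 -mulr2n -mulr_natl.
have -> : - k * (2 * x) = - (x / s ^+ 2) by rewrite /k; field.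
by rewrite mulrA mulrC.
Qed.

Let cphi : continuous phi. Proof. exact: continuous_normal_pdf. Qed.

Let phi_ge0 x : 0 <= phi x. Proof. exact: normal_pdf_ge0. Qed.

Lemma cvg_id_normal_pdf : x * phi x @[x --> +oo] --> (0 : R).
Proof.
apply: (@squeeze_cvgr _ _ _ _ (cst 0)
  (fun x => (normal_peak s * (s ^+ 2 *+ 2)) * x^-1)); last 2 first.
- exact: cvg_cst.
- rewrite -[X in _ --> X](mulr0 (normal_peak s * (s ^+ 2 *+ 2))); apply: cvgM.
    exact: cvg_cst.
  exact: (gtr0_cvgV0 (nbhs_pinfty_gt (num_real 0))).2.
near=> x.
have x0 : 0 < x by near: x; exact: nbhs_pinfty_gt.
apply/andP; split; first by rewrite mulr_ge0 ?phi_ge0 ?ltW.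
have -> : phi x = normal_peak s * normal_fun 0 s x by rewrite normal_pdfE.
rewrite mulrCA -mulrA ler_wpM2l ?normal_peak_ge0//.
rewrite ler_pdivlMr// mulrAC -expr2 /normal_fun subr0 mulNr expRN.
rewrite ler_pdivrMr ?expR_gt0//.
set c := s ^+ 2 *+ 2.
have c0 : 0 < c by rewrite mulrn_wgt0// exprn_gt0.
apply: (@le_trans _ _ (c * (1 + x ^+ 2 / c))).
  by rewrite mulrDr mulr1 mulrCA divff ?mulr1 ?gt_eqF// lerDr ltW.
by rewrite ler_pM2l// expR_ge1Dx.
Unshelve. all: by end_near. Qed.

Let psi x := x * phi x.

Let dpsi x : is_derive x (1 : R) psi ((1 - x ^+ 2 / s ^+ 2) * phi x).
Proof.
have ? := is_derive_normal_pdf x.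
apply: is_derive_eq; rewrite /GRing.scale /=; field.
by [].
Qed.

Let cpsi : continuous psi.
Proof. by move=> x; apply: cvgM; [exact: cvg_id|exact: cphi]. Qed.

Let m2 x := x ^+ 2 / s ^+ 2 * phi x.

Let cm2 : continuous m2.
Proof.
move=> x; apply: cvgM; last exact: cphi.
apply: cvgM; last exact: cvg_cst.
exact: sqr_continuous.
Qed.

Let m2_ge0 x : 0 <= m2 x.
Proof. by rewrite mulr_ge0// divr_ge0// ?sqr_ge0. Qed.

Let mphi (D : set R) : measurable_fun D (EFin \o phi).
Proof.
by apply/measurable_EFinP; apply: measurable_funTS; exact: measurable_normal_pdf.
Qed.

Let mm2 (D : set R) : measurable_fun D (EFin \o m2).
Proof.
by apply/measurable_EFinP; apply: measurable_funTS; exact: continuous_measurable_fun.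
Qed.

(* The derivative of [psi] is [phi - m2], which is nonnegative on [0, s] and
   nonpositive beyond [s]; the fundamental theorem of calculus needs a constant
   sign on the unbounded interval, whence the split at [s]. *)
Let m2_tail : (\int[mu]_(x in `[s, +oo[) (m2 x)%:E =
  \int[mu]_(x in `[s, +oo[) (phi x)%:E + (psi s)%:E)%E.
Proof.
have f_ge0 x : s <= x -> 0 <= m2 x - phi x.
  move=> sx; rewrite /m2 -[X in _ - X]mul1r -mulrBl mulr_ge0//.
  rewrite subr_ge0 ler_pdivlMr ?exprn_gt0// mul1r.
  by rewrite ler_sqr ?nnegrE// ltW// (lt_le_trans s0).
have cf : continuous (fun x => m2 x - phi x).
  by move=> x; apply: cvgB; [exact: cm2|exact: cphi].
have : (\int[mu]_(x in `[s, +oo[) (m2 x - phi x)%:E = 0%:E - (- psi s)%:E)%E.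
  apply: (@ge0_continuous_FTC2y _ _ (fun x => - psi x)) => //.
  - exact: continuous_subspaceT.
  - by rewrite -oppr0; apply: cvgN; exact: cvg_id_normal_pdf.
  - by move=> x _; have ? := dpsi x; apply: ex_derive.
  - by apply: cvgN; apply: cvg_at_right_filter; exact: cpsi.
  - move=> x _; have ? := dpsi x; rewrite derive1E derive_val /m2; ring.
rewrite -EFinB sub0r opprK => <-.
rewrite -ge0_integralD//=.
- by apply: eq_integral => x _; rewrite -EFinD addrC subrK.
- by move=> x _; rewrite lee_fin.
- exact: mphi.
- by move=> x; rewrite in_itv/= andbT lee_fin; exact: f_ge0.
- apply/measurable_EFinP; apply: measurable_funTS.
  exact: continuous_measurable_fun.
Qed.

Let m2_head : (\int[mu]_(x in `[0%R, s]) (phi x)%:E =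
  \int[mu]_(x in `[0%R, s]) (m2 x)%:E + (psi s)%:E)%E.
Proof.
have f_ge0 x : 0 <= x <= s -> 0 <= phi x - m2 x.
  move=> /andP[x0 xs]; rewrite /m2 -[X in X - _]mul1r -mulrBl mulr_ge0//.
  by rewrite subr_ge0 ler_pdivrMr ?exprn_gt0// mul1r ler_sqr ?nnegrE// (le_trans x0).
have cf : continuous (fun x => phi x - m2 x).
  by move=> x; apply: cvgB; [exact: cphi|exact: cm2].
have : (\int[mu]_(x in `[0%R, s]) (phi x - m2 x)%:E = (psi s)%:E - (psi 0)%:E)%E.
  apply: continuous_FTC2 => //.
  - exact: continuous_subspaceT.
  - split=> [x _||]; first by have ? := dpsi x; apply: ex_derive.
    + by apply: cvg_at_right_filter; exact: cpsi.
    + by apply: cvg_at_left_filter; exact: cpsi.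
  - by move=> x _; have ? := dpsi x; rewrite derive1E derive_val /m2; ring.
rewrite {2}/psi mul0r sube0 => <-.
rewrite -ge0_integralD//=.
- by apply: eq_integral => x _; rewrite -EFinD addrC subrK.
- by move=> x _; rewrite lee_fin.
- exact: mm2.
- apply/measurable_EFinP; apply: measurable_funTS.
  exact: continuous_measurable_fun.
Qed.

Let split0 (h : R -> R) : continuous h -> (forall x, 0 <= h x) ->
  (forall x, h (- x) = h x) ->
  (\int[mu]_x (h x)%:E = 2%:E * (\int[mu]_(x in `[0%R, s]) (h x)%:E +
    \int[mu]_(x in `[s, +oo[) (h x)%:E))%E.
Proof.
move=> ch h0 he.
have mh D : measurable_fun D (EFin \o h).
  apply/measurable_EFinP; apply: measurable_funTS.
  exact: continuous_measurable_fun.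
rewrite ge0_symfun_integralT//; last by move=> x /=; rewrite he.
congr (_ * _)%E; rewrite -set_itvcy.
rewrite -[in RHS]integral_itv_obnd_cbnd//.
rewrite -ge0_integral_setU//=.
- by rewrite -itv_bndbnd_setU ?bnd_simp// ltW.
- exact: mh.
- by move=> x _; rewrite lee_fin.
- apply/disj_setPS => x [] /=; rewrite !in_itv/= andbT => /andP[_ xs] sx.
  by move: (lt_le_trans sx xs); rewrite ltxx.
Qed.

Let phi_even x : phi (- x) = phi x.
Proof. by rewrite !normal_pdfE// /normal_fun !subr0 sqrrN. Qed.

Lemma integral_normal_pdf_sqr :
  (\int[mu]_x (x ^+ 2 * phi x)%:E = (s ^+ 2)%:E)%E.
Proof.
transitivity ((s ^+ 2)%:E * \int[mu]_x (m2 x)%:E)%E.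
  rewrite -ge0_integralZl//=.
  - by apply: eq_integral => x _; rewrite -EFinM /m2; congr EFin; field.
  - exact: mm2.
  - by move=> x _; rewrite lee_fin.
  - by rewrite lee_fin sqr_ge0.
rewrite split0//; last by move=> x; rewrite /m2 sqrrN phi_even.
rewrite m2_tail addeCA -m2_head addeC -split0//.
by rewrite integral_normal_pdf mule1.
Qed.

(** This is how the symmetry of the law is used: subtracting the two sides
    shows that the first moment vanishes, see [expectation_normal0]. *)
Lemma integral_normal_pdf_abs :
  (\int[mu]_x (`|x| * phi x)%:E = 2%:E * \int[mu]_x (Num.max x 0 * phi x)%:E)%E.
Proof.
have c1 : continuous (fun x => `|x| * phi x).
  by move=> x; apply: cvgM; [exact: norm_continuous|exact: cphi].
rewrite ge0_symfun_integralT//; last 2 first.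
- by move=> x; rewrite mulr_ge0.
- by move=> x /=; rewrite normrN phi_even.
congr (_ * _)%E; rewrite integral_mkcond; apply: eq_integral => x _.
rewrite patchE; case: ifPn; rewrite ?inE ?notin_setE/=.
  by move=> x0; rewrite ger0_norm// max_l.
by move=> /negP; rewrite -ltNge => x0; rewrite max_r ?mul0r// ltW.
Qed.

End normal_moments.

Section normal_law.
Context {d} {T : measurableType d} {R : realType} (P : probability T R).
Context (Z : T -> R) (mZ : measurable_fun setT Z) (s : R) (s0 : 0 < s).
Hypothesis lawZ : forall B, measurable B -> P (Z @^-1` B) = normal_prob 0 s B.

(* Both Borel structures on the real line are used: the law lives on the one
   that carries the Lebesgue measure. *)
Let ge0_expect (h : R -> R) : measurable_fun setT h -> (forall x, 0 <= h x) ->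
  (\int[P]_w (h (Z w))%:E =
   \int[lebesgue_measure]_x (h x * normal_pdf 0 s x)%:E)%E.
Proof.
move=> mh h0.
have mZ' : @measurable_fun _ _ T (measurableTypeR R) setT Z by exact: mZ.
pose Zm : {mfun T >-> measurableTypeR R} :=
  HB.pack (Z : T -> measurableTypeR R) (isMeasurableFun.Build _ _ _ _ _ mZ').
transitivity (\int[distribution P Zm]_x (h x)%:E)%E.
  by rewrite ge0_integral_distribution//; exact/measurable_EFinP.
apply: (@ge0_integral_density _ _ R (@lebesgue_measure R) (distribution P Zm)
  (normal_pdf 0 s)) => //.
- exact: measurable_normal_pdf.
- by move=> x; exact: normal_pdf_ge0.
Qed.

Lemma expectation_normal_sqr : (\int[P]_w (Z w ^+ 2)%:E = (s ^+ 2)%:E)%E.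
Proof.
rewrite (ge0_expect (fun x => x ^+ 2)) ?integral_normal_pdf_sqr//.
by move=> x; exact: sqr_ge0.
Qed.

Lemma integrable_normal_sqr : P.-integrable setT (fun w => (Z w ^+ 2)%:E).
Proof.
apply/integrableP; split.
  by apply/measurable_EFinP; exact: measurable_funX.
under eq_integral do rewrite gee0_abs ?lee_fin ?sqr_ge0//.
by rewrite expectation_normal_sqr ltry.
Qed.

Lemma integrable_normal : P.-integrable setT (fun w => (Z w)%:E).
Proof.
apply: (@le_integrable _ _ _ _ _ measurableT _ (fun w => (1 + Z w ^+ 2)%:E)).
- exact/measurable_EFinP.
- move=> w _ /=; rewrite lee_fin [leRHS]ger0_norm ?addr_ge0 ?sqr_ge0//.
  rewrite -real_normK ?num_real//; have := sqr_ge0 (`|Z w| - 1); nra.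
- under eq_fun do rewrite EFinD.
  apply: integrableD => //; last exact: integrable_normal_sqr.
  exact: finite_measure_integrable_cst.
Qed.

Lemma expectation_normal0 : (\int[P]_w (Z w)%:E = 0)%E.
Proof.
have iabs : P.-integrable setT (fun w => `|(Z w)%:E|)%E.
  exact: (integrable_abse integrable_normal).
have imax : P.-integrable setT (fun w => (Num.max (Z w) 0)%:E)%E.
  apply: (le_integrable measurableT _ _ integrable_normal).
    by apply/measurable_EFinP; exact: measurable_maxr.
  move=> w _ /=; rewrite lee_fin.
  by case: (leP (Z w) 0) => // _; rewrite normr0.
transitivity (\int[P]_w (2%:E * (Num.max (Z w) 0)%:E - `|(Z w)%:E|))%E.
  apply: eq_integral => w _; rewrite /= -EFinM -EFinB; congr EFin.
  case: (leP (Z w) 0) => Zw; first by rewrite mulr0 sub0r ler0_norm// opprK.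
  by rewrite gtr0_norm// mulr_natl mulr2n addrK.
rewrite integralB//; last exact: integrableZl.
rewrite integralZl//.
have -> : (\int[P]_w `|(Z w)%:E| = \int[P]_w (`|Z w|)%:E)%E by [].
have absE : (\int[P]_w `|(Z w)%:E| = 2%:E * \int[P]_w (Num.max (Z w) 0)%:E)%E.
  rewrite (ge0_expect (fun x => `|x|))// (ge0_expect (fun x => Num.max x 0))//.
  - exact: integral_normal_pdf_abs.
  - exact: measurable_maxr.
  - by move=> x; rewrite le_max lexx orbT.
rewrite absE subee//; apply: fin_numM => //.
exact: integrable_fin_num.
Qed.

End normal_law.

(** * Independence *)

Section independent_product.
Context {d} {T : measurableType d} {R : realType} (P : probability T R).
Context (Y Z : T -> R) (mY : measurable_fun setT Y) (mZ : measurable_fun setT Z).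
Hypothesis indYZ : forall A B, measurable A -> measurable B ->
  P (Y @^-1` A `&` Z @^-1` B) = (P (Y @^-1` A) * P (Z @^-1` B))%E.
Hypothesis iY : P.-integrable setT (EFin \o Y).
Hypothesis iZ : P.-integrable setT (EFin \o Z).

Let Ym : {mfun T >-> R} := HB.pack Y (isMeasurableFun.Build _ _ _ _ _ mY).
Let Zm : {mfun T >-> R} := HB.pack Z (isMeasurableFun.Build _ _ _ _ _ mZ).
Let YZ w := (Y w, Z w).
Let mYZ : measurable_fun setT YZ. Proof. exact: measurable_fun_pair. Qed.
Let YZm : {mfun T >-> (R * R)%type} :=
  HB.pack YZ (isMeasurableFun.Build _ _ _ _ _ mYZ).

(* Independence says that the joint law is the product of the marginals, so
   that the product formula for expectations is Fubini's theorem. *)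
Let law_pair X : measurable X ->
  (distribution P Ym \x distribution P Zm)%E X = distribution P YZm X.
Proof.
apply: product_measure_unique => A B mA mB.
by rewrite -[RHS]indYZ.
Qed.

Let mmul : measurable_fun setT (fun z : R * R => (z.1 * z.2)%:E).
Proof. by apply/measurable_EFinP; exact: measurable_funM. Qed.

Let mmula : measurable_fun setT (fun z : R * R => `|(z.1 * z.2)%:E|%E).
Proof. exact: measurableT_comp. Qed.

Let mabs : measurable_fun [set: R] (fun z => `|z%:E|%E).
Proof. by apply: measurableT_comp => //; exact/measurable_EFinP. Qed.

Let prod_fin : (\int[distribution P Ym \x distribution P Zm]_z
  `|(z.1 * z.2)%:E| < +oo)%E.
Proof.
rewrite fubini_tonelli1// /fubini_F/=.
under eq_integral.
  move=> y _.
  under eq_integral do rewrite normrM EFinM.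
  rewrite ge0_integralZl//.
  over.
rewrite ge0_integralZr//; last exact: integral_ge0.
rewrite (ge0_integral_distribution Ym (f := fun z => `|z%:E|%E))//.
rewrite (ge0_integral_distribution Zm (f := fun z => `|z%:E|%E))//.
have /integrableP[_ Yoo] := iY; have /integrableP[_ Zoo] := iZ.
apply: lte_mul_pinfty.
- by apply: integral_ge0 => w _; exact: abse_ge0.
- by rewrite ge0_fin_numE//; apply: integral_ge0 => w _; exact: abse_ge0.
- exact: Zoo.
Qed.

Lemma integrable_indep_mul : P.-integrable setT (fun w => (Y w * Z w)%:E).
Proof.
apply/integrableP; split.
  by apply/measurable_EFinP; exact: measurable_funM.
have YZE := ge0_integral_distribution YZm mmula (fun z => abse_ge0 _).
rewrite [X in (X < _)%E](_ : _ = \int[P]_w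
  (abse \o (fun z : R * R => (z.1 * z.2)%:E) \o YZm) w)%E//.
rewrite -YZE (eq_measure_integral (distribution P Ym \x distribution P Zm)%E)//.
by move=> A mA _; exact/esym/law_pair.
Qed.

Lemma integral_indep_mul : (\int[P]_w (Y w * Z w)%:E =
  \int[P]_w (Y w)%:E * \int[P]_w (Z w)%:E)%E.
Proof.
have := @integral_distribution _ _ _ _ _ P YZm _ mmul integrable_indep_mul.
rewrite /comp /= => <-.
rewrite (eq_measure_integral (distribution P Ym \x distribution P Zm)%E); last first.
  by move=> A mA _; exact/esym/law_pair.
rewrite -integral12_prod_meas1/=; last by apply/integrableP.
rewrite /fubini_F/=.
have iZd : (distribution P Zm).-integrable setT EFin.
  by apply: integrable_pushforward.
have iYd : (distribution P Ym).-integrable setT EFin.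
  by apply: integrable_pushforward.
under eq_integral.
  move=> y _.
  under eq_integral do rewrite EFinM.
  rewrite integralZl//.
  over.
rewrite /= -(@fineK _ (\int[distribution P Zm]_x x%:E)%E); last first.
  exact: integrable_fin_num.
rewrite integralZr// fineK; last exact: integrable_fin_num.
rewrite (@integral_distribution _ _ _ _ _ P Ym EFin)//.
by rewrite (@integral_distribution _ _ _ _ _ P Zm EFin).
Qed.

End independent_product.

(** * Measurability *)

Section continuous_dependence.
Context {d} {T : measurableType d} {R : realType} {I : finType}.
Context (h : I -> T -> R) (mh : forall i, measurable_fun setT (h i)).

(** A set that is open for the topology induced by finitely many measurable
    functions is a union of preimages of boxes with rational centres and
    radii [1/n], and there are only countably many of those. *)
Lemma measurable_open_dependence (S : set T) :
  (forall w, S w -> exists2 e : R, 0 < e &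
    forall w', (forall i, `|h i w' - h i w| < e) -> S w') ->
  measurable S.
Proof.
move=> Sopen.
pose box (p : {ffun I -> rat} * nat) : set T :=
  \bigcap_(i in [set: I]) (h i @^-1` [set x | `|x - ratr (p.1 i)| < p.2.+1%:R^-1]).
have mbox p : measurable (box p).
  apply: fin_bigcap_measurable => // i _; rewrite -[X in measurable X]setTI.
  apply: mh => //.
  rewrite [X in measurable X](_ : _ = ball (ratr (p.1 i) : R^o) p.2.+1%:R^-1).
    exact: measurable_ball.
  by apply/seteqP; split=> x; rewrite -ball_normE/= distrC.
pose inner p := if pselect (box p `<=` S) then box p else set0.
rewrite [S](_ : _ = \bigcup_p inner p); last first.
  apply/seteqP; split=> [w Sw|w [p _]]; last first.
    by rewrite /inner; case: pselect => // boxS /boxS.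
  have [e e0 he] := Sopen _ Sw.
  pose n := Num.truncn (2 / e).
  have n0 : 0 < (n.+1%:R^-1 : R) by rewrite invr_gt0.
  have ne : n.+1%:R^-1 < e / 2.
    rewrite invf_plt ?posrE ?divr_gt0//.
    by rewrite invf_div; apply: truncnS_gt; rewrite ?num_real ?divr_ge0 ?ltW.
  have [k kE] : exists k : R, n.+1%:R^-1 = k by exists n.+1%:R^-1.
  rewrite kE in n0 ne.
  have near_rat i : exists q : rat, `|h i w - ratr q| < k.
    have [|q] := @rat_in_itvoo R (h i w - k) (h i w + k); first by lra.
    rewrite in_itv/= => /andP[q1 q2]; exists q.
    by rewrite ltr_norml; apply/andP; split; lra.
  have [q hq] := choice near_rat.
  exists ([ffun i => q i], n) => //; rewrite /inner; case: pselect => [?|[]].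
    by move=> i _ /=; rewrite ffunE kE.
  move=> w' /= boxw'; apply: he => i.
  have := boxw' i Logic.I; rewrite /= ffunE kE => w'q.
  rewrite (le_lt_trans (ler_distD (ratr (q i)) _ _))// (distrC _ (h i w)).
  by have := hq i; lra.
apply: countable_bigcupT_measurable; first exact: countableP.
by move=> p; rewrite /inner; case: pselect => ? /=; [exact: mbox|exact: measurable0].
Qed.

Lemma measurable_fun_continuous_dependence (f : T -> R) :
  (forall w e, 0 < e -> exists2 r : R, 0 < r &
    forall w', (forall i, `|h i w' - h i w| < r) -> `|f w' - f w| < e) ->
  measurable_fun setT f.
Proof.
move=> fc; apply: (measurability _ (RGenOpens.measurableE R)).
move=> _ [_ [a [b ->]] <-]; rewrite setTI.
apply: measurable_open_dependence => w /=; rewrite in_itv/= => /andP[aw wb].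
have [|r r0 hr] := fc w (Num.min (f w - a) (b - f w)).
  by rewrite lt_min !subr_gt0 aw wb.
exists r => // w' /hr; rewrite lt_min !ltr_norml in_itv/=.
by move=> /andP[/andP[? ?] /andP[? ?]]; apply/andP; split; lra.
Qed.

End continuous_dependence.

Lemma borel_continuous_preimage {S : topologicalType} {R : realType}
    (phi : S -> R) (B : set R) :
  continuous phi -> measurable B -> borel (phi @^-1` B).
Proof.
move=> cphi; pose G : set (set R) := [set B | borel (phi @^-1` B)].
have sG : sigma_algebra setT G.
  split=> [|A|A]; rewrite /G/=.
  - by rewrite preimage_set0; exact: sigma_algebra0.
  - by rewrite setTD preimage_setC -setTD; exact: sigma_algebraCD.
  - by rewrite preimage_bigcup => ?; exact: sigma_algebra_bigcup.
suff : measurable `<=` G by exact.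
rewrite [X in X `<=` _](RGenOpens.measurableE R).
apply: smallest_sub => // _ [a [b ->]].
by apply: sub_sigma_algebra; apply: open_comp => // x _; exact: cphi.
Qed.

(** Matrices carry no measurable structure here; for the entrywise notion the
    measurable space [T] can be a sub-sigma-algebra, which expresses
    adaptedness. *)
Definition measurable_mx {d} {T : measurableType d} {R : realType} {a b : nat}
    (X : T -> 'M[R]_(a, b)) : Prop :=
  forall i j, measurable_fun setT (fun w => X w i j).

(** The Borel sigma-algebra of a product of matrix spaces is generated by the
    coordinates, because its topology has a countable base. *)
Lemma measurable_mx_pair_borel {d} {T : measurableType d} {R : realType}
    {a b p : nat} (X : T -> 'M[R]_(a, p)) (Y : T -> 'M[R]_(b, p))
    (B : set ('M[R]_(a, p) * 'M[R]_(b, p))) :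
  measurable_mx X -> measurable_mx Y -> borel B ->
  measurable [set w | B (X w, Y w)].
Proof.
move=> mX mY; pose G := [set B | measurable [set w | B (X w, Y w)]].
have sG : sigma_algebra setT G.
  split=> [|A mA|A mA]; rewrite /G/=.
  - exact: measurable0.
  - rewrite [X in measurable X](_ : _ = ~` [set w | A (X w, Y w)]).
      exact: measurableC.
    by apply/seteqP; split => w /= => [[]|].
  - rewrite [X in measurable X](_ : _ = \bigcup_n [set w | A n (X w, Y w)]).
      exact: bigcupT_measurable.
    by apply/seteqP; split => w /= [n]; exists n.
suff BG : @borel ('M[R]_(a, p) * 'M[R]_(b, p))%type `<=` G by move=> /BG.
apply: smallest_sub => // O oO; rewrite /G/=.
pose h (l : 'I_a * 'I_p + 'I_b * 'I_p) w :=
  match l with inl l => X w l.1 l.2 | inr l => Y w l.1 l.2 end.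
apply: (@measurable_open_dependence _ _ _ _ h) => [[] l|w Ow].
- exact: mX.
- exact: mY.
have /nbhs_ballP[e /= e0 he] : nbhs (X w, Y w) O by exact: open_nbhs_nbhs.
exists e => // w' hw; apply: he; split => /=.
  by split=> // i j; rewrite -ball_normE/= distrC; exact: (hw (inl (i, j))).
by split=> // i j; rewrite -ball_normE/= distrC; exact: (hw (inr (i, j))).
Qed.

Lemma measurable_mx_borel_comp {d} {T : measurableType d} {R : realType}
    {a b p u v : nat} (X : T -> 'M[R]_(a, p)) (Y : T -> 'M[R]_(b, p))
    (g : 'M[R]_(a, p) -> 'M[R]_(b, p) -> 'M[R]_(u, v)) :
  borel_fun (fun z : 'M[R]_(a, p) * 'M[R]_(b, p) => g z.1 z.2) ->
  measurable_mx X -> measurable_mx Y -> measurable_mx (fun w => g (X w) (Y w)).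
Proof.
move=> bg mX mY i j _ B mB; rewrite setTI.
have cij : continuous (fun A : 'M[R]_(u, v) => A i j).
  by move=> A; exact: coord_continuous.
have bB := bg _ (borel_continuous_preimage _ _ cij mB).
by have := measurable_mx_pair_borel X Y _ mX mY bB.
Qed.

Lemma measurable_mxD {d} {T : measurableType d} {R : realType} {a b : nat}
    (X Y : T -> 'M[R]_(a, b)) :
  measurable_mx X -> measurable_mx Y -> measurable_mx (fun w => X w + Y w).
Proof.
move=> mX mY i j; under eq_fun do rewrite mxE; exact: measurable_funD.
Qed.

Lemma measurable_mxM {d} {T : measurableType d} {R : realType} {a b c : nat}
    (X : T -> 'M[R]_(a, b)) (Y : T -> 'M[R]_(b, c)) :
  measurable_mx X -> measurable_mx Y -> measurable_mx (fun w => X w *m Y w).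
Proof.
move=> mX mY i j; under eq_fun do rewrite mxE.
by apply: measurable_sum => k; exact: measurable_funM.
Qed.

(** * Euclidean and trace norms *)

Section norms.
Context {R : realType} {d : nat}.
Implicit Types x y z : 'cV[R]_d.

Lemma dotvC x y : dotv x y = dotv y x.
Proof. by apply: eq_bigr => i _; rewrite mulrC. Qed.

Lemma dotvDr x y z : dotv x (y + z) = dotv x y + dotv x z.
Proof. by rewrite -big_split; apply: eq_bigr => i _; rewrite mxE mulrDr. Qed.

Lemma dotvZr (c : R) x y : dotv x (c *: y) = c * dotv x y.
Proof. by rewrite /dotv mulr_sumr; apply: eq_bigr => i _; rewrite mxE mulrCA. Qed.

Lemma dotvNr x y : dotv x (- y) = - dotv x y.
Proof. by rewrite -scaleN1r dotvZr mulN1r. Qed.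

Lemma dotvDl x y z : dotv (x + y) z = dotv x z + dotv y z.
Proof. by rewrite dotvC dotvDr !(dotvC z). Qed.

Lemma dotvZl (c : R) x y : dotv (c *: x) y = c * dotv x y.
Proof. by rewrite dotvC dotvZr dotvC. Qed.

Lemma dotvNl x y : dotv (- x) y = - dotv x y.
Proof. by rewrite dotvC dotvNr dotvC. Qed.

Lemma dotv_ge0 x : 0 <= dotv x x.
Proof. by apply: sumr_ge0 => i _; rewrite -expr2 sqr_ge0. Qed.

Lemma enorm_ge0 x : 0 <= enorm x. Proof. exact: sqrtr_ge0. Qed.

Lemma sqr_enorm x : enorm x ^+ 2 = dotv x x.
Proof. by rewrite sqr_sqrtr ?dotv_ge0. Qed.

Lemma sqr_enormE x : enorm x ^+ 2 = \sum_(i < d) x i 0 ^+ 2.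
Proof. by rewrite sqr_enorm; apply: eq_bigr => i _; rewrite expr2. Qed.

Lemma enormZ (c : R) x : enorm (c *: x) = `|c| * enorm x.
Proof.
rewrite /enorm dotvZl dotvZr mulrA -expr2 sqrtrM ?sqr_ge0//.
by rewrite sqrtr_sqr.
Qed.

Lemma ler_dotv_enorm x y : 2 * dotv x y <= enorm x ^+ 2 + enorm y ^+ 2.
Proof.
have := dotv_ge0 (x - y).
rewrite !sqr_enorm !(dotvDl, dotvDr, dotvNl, dotvNr) (dotvC y x); lra.
Qed.

Lemma cauchy_schwarz x y : dotv x y <= enorm x * enorm y.
Proof.
have [x0|x0] := eqVneq (enorm x) 0.
  have /eqP := sqr_enormE x; rewrite x0 expr0n/= eq_sym psumr_eq0; last first.
    by move=> i _; exact: sqr_ge0.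
  move=> /allP xi; rewrite mul0r /dotv big1// => i _.
  by have := xi i (mem_index_enum _); rewrite sqrf_eq0 => /eqP ->; rewrite mul0r.
have [y0|y0] := eqVneq (enorm y) 0.
  have /eqP := sqr_enormE y; rewrite y0 expr0n/= eq_sym psumr_eq0; last first.
    by move=> i _; exact: sqr_ge0.
  move=> /allP yi; rewrite mulr0 /dotv big1// => i _.
  by have := yi i (mem_index_enum _); rewrite sqrf_eq0 => /eqP ->; rewrite mulr0.
have x1 : 0 < enorm x by rewrite lt_neqAle eq_sym x0 enorm_ge0.
have y1 : 0 < enorm y by rewrite lt_neqAle eq_sym y0 enorm_ge0.
have := ler_dotv_enorm ((enorm x)^-1 *: x) ((enorm y)^-1 *: y).
rewrite dotvZl dotvZr !enormZ !ger0_norm ?invr_ge0 ?enorm_ge0//.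
rewrite !mulVf// expr1n.
have -> : (enorm x)^-1 * ((enorm y)^-1 * dotv x y) = dotv x y / (enorm x * enorm y).
  by field; rewrite x0 y0.
move=> le2; have : dotv x y / (enorm x * enorm y) <= 1 by lra.
by rewrite ler_pdivrMr ?mulr_gt0// mul1r.
Qed.

Lemma ler_enormD x y : enorm (x + y) <= enorm x + enorm y.
Proof.
rewrite -(@ler_sqr R) ?nnegrE ?addr_ge0 ?enorm_ge0// sqrrD !sqr_enorm.
rewrite dotvDl !dotvDr (dotvC y x); have := cauchy_schwarz x y.
lra.
Qed.

Lemma sqr_trnormE {m : nat} (g : 'M[R]_(d, m)) :
  trnorm g ^+ 2 = \sum_(b < m) \sum_(a < d) g a b ^+ 2.
Proof.
rewrite sqr_sqrtr /mxtrace; last first.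
  apply: sumr_ge0 => i _; rewrite mxE; apply: sumr_ge0 => j _.
  by rewrite mxE -expr2 sqr_ge0.
apply: eq_bigr => b _; rewrite mxE; apply: eq_bigr => a _.
by rewrite mxE expr2.
Qed.

End norms.

Section measurable_norms.
Context {d} {T : measurableType d} {R : realType} {n m : nat}.

Lemma measurable_sqr_enorm (X : T -> 'cV[R]_n) : measurable_mx X ->
  measurable_fun setT (fun w => enorm (X w) ^+ 2).
Proof.
move=> mX; under eq_fun do rewrite sqr_enormE.
by apply: measurable_sum => i; exact: measurable_funX.
Qed.

Lemma measurable_enorm (X : T -> 'cV[R]_n) : measurable_mx X ->
  measurable_fun setT (fun w => enorm (X w)).
Proof.
move=> mX; apply: (measurableT_comp (@continuous_measurable_fun R Num.sqrt _)).
  exact: sqrt_continuous.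
by apply: measurable_sum => i; exact: measurable_funM.
Qed.

Lemma measurable_sqr_trnorm (g : T -> 'M[R]_(n, m)) : measurable_mx g ->
  measurable_fun setT (fun w => trnorm (g w) ^+ 2).
Proof.
move=> mg; under eq_fun do rewrite sqr_trnormE.
by apply: measurable_sum => b; apply: measurable_sum => a; exact: measurable_funX.
Qed.

End measurable_norms.

(** * Brownian increments *)

Lemma measurable_fun_coarser {d d'} {T : measurableType d} {U : measurableType d'}
    (G G' : set (set T)) (h : T -> U) :
  G `<=` G' ->
  measurable_fun [set: g_sigma_algebraType G] (h : g_sigma_algebraType G -> U) ->
  measurable_fun [set: g_sigma_algebraType G'] (h : g_sigma_algebraType G' -> U).
Proof.
move=> GG' mh _ B mB; apply: (@sub_sigma_algebra2 _ setT G' G GG').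
exact: (mh measurableT B mB).
Qed.

Lemma measurable_fun_sub_sigma {d d'} {T : measurableType d} {U : measurableType d'}
    (G : set (set T)) (h : T -> U) : G `<=` measurable ->
  measurable_fun [set: g_sigma_algebraType G] (h : g_sigma_algebraType G -> U) ->
  measurable_fun [set: T] h.
Proof.
move=> GM mh _ B mB; have := mh measurableT B mB; rewrite !setTI.
apply: smallest_sub => //; split=> [|A|A].
- exact: measurable0.
- by move=> ?; exact: measurableD.
- by move=> ?; exact: bigcupT_measurable.
Qed.

Section brownian_increment.
Context {R : realType} {disp : measure_display} {Omega : measurableType disp}.
Context (P : probability Omega R) (F : R -> set (set Omega)).
Hypothesis hF : filtration_usual P F.
Context {m : nat} (W : R -> Omega -> 'cV[R]_m).
Hypothesis hW : brownian_motion P F W.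
Context (s t : R) (s0 : 0 <= s) (st : s < t).

Local Notation dW := (fun w => W t w - W s w).
Local Notation dWi i := (fun w => (W t w - W s w)%R i 0%R).
Local Notation Fs := (g_sigma_algebraType (F s)).

Lemma brownian_adapted_mx (u : R) : 0 <= u ->
  @measurable_mx _ (g_sigma_algebraType (F u)) R _ _ (W u).
Proof.
move=> u0 i j _ B mB; rewrite setTI.
apply: sub_sigma_algebra.
have cij : continuous (fun A : 'cV[R]_m => A i j).
  by move=> A; exact: coord_continuous.
exact: (brownian_adapted hW u0 (borel_continuous_preimage _ _ cij mB)).
Qed.

Lemma measurable_increment i : measurable_fun setT (dWi i).
Proof.
under eq_fun do rewrite !mxE.
have t0 : 0 <= t by rewrite (le_trans s0)// ltW.
apply: measurable_funB.
  exact: (measurable_fun_sub_sigma _ _ (filtration_measurable hF t0)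
    (brownian_adapted_mx t t0 i 0)).
exact: (measurable_fun_sub_sigma _ _ (filtration_measurable hF s0)
  (brownian_adapted_mx s s0 i 0)).
Qed.

Local Notation sd := (Num.sqrt (t - s)).

Let sd_gt0 : 0 < sd. Proof. by rewrite sqrtr_gt0 subr_gt0. Qed.

Lemma increment_law i B : measurable B ->
  P (dWi i @^-1` B) = normal_prob 0 sd B.
Proof.
move=> mB; pose C (j : 'I_m) := if j == i then B else setT.
have := @brownian_normal _ _ _ _ _ _ _ hW s t C s0 st.
rewrite (_ : [set w | _] = dWi i @^-1` B); last first.
  apply/seteqP; split => w /=; first by move=> /(_ i); rewrite /C eqxx.
  by move=> Bw j; rewrite /C; case: eqP => // ->.
move=> ->; last by move=> j; rewrite /C; case: ifP.
rewrite (bigD1 i)//= {1}/C eqxx big1 ?mule1// => j /negbTE ji.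
by rewrite /C ji probability_setT.
Qed.

Lemma increment_pair_law i j A B : i != j -> measurable A -> measurable B ->
  P (dWi i @^-1` A `&` dWi j @^-1` B) =
  (P (dWi i @^-1` A) * P (dWi j @^-1` B))%E.
Proof.
move=> ij mA mB; rewrite !increment_law//.
pose C (k : 'I_m) := if k == i then A else if k == j then B else setT.
have := @brownian_normal _ _ _ _ _ _ _ hW s t C s0 st.
rewrite (_ : [set w | _] = dWi i @^-1` A `&` dWi j @^-1` B); last first.
  apply/seteqP; split => w /=.
    move=> h; split; first by have := h i; rewrite /C eqxx.
    by have := h j; rewrite /C eq_sym (negbTE ij) eqxx.
  by move=> [Aw Bw] k; rewrite /C; case: eqP => [->//|_]; case: eqP => [->|].
move=> ->; last by move=> k; rewrite /C; case: ifP => // _; case: ifP.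
rewrite (bigD1 i)//= {1}/C eqxx (bigD1 j) 1?eq_sym//= {1}/C.
rewrite eq_sym (negbTE ij) eqxx big1 ?mule1// => k /andP[/negbTE ki /negbTE kj].
by rewrite /C ki kj probability_setT.
Qed.

Lemma integrable_increment i : P.-integrable setT (fun w => (dWi i w)%:E).
Proof.
exact: (integrable_normal P _ (measurable_increment i) sd sd_gt0 (increment_law i)).
Qed.

Lemma expectation_increment i : (\int[P]_w (dWi i w)%:E = 0)%E.
Proof.
exact: (expectation_normal0 P _ (measurable_increment i) sd sd_gt0 (increment_law i)).
Qed.

Local Notation cov i j := (fun w => dWi i w * dWi j w - (t - s) * (i == j)%:R).

Lemma increment_product i j :
  P.-integrable setT (fun w => (dWi i w * dWi j w)%:E) /\
  (\int[P]_w (dWi i w * dWi j w)%:E = ((t - s) * (i == j)%:R)%:E)%E.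
Proof.
have [<-|ij] := eqVneq i j.
  split.
    exact: (integrable_normal_sqr P _ (measurable_increment i) sd sd_gt0
      (increment_law i)).
  rewrite mulr1.
  rewrite [LHS](expectation_normal_sqr P _ (measurable_increment i) sd sd_gt0
    (increment_law i)).
  by rewrite sqr_sqrtr// subr_ge0 ltW.
have h := fun A B => increment_pair_law i j A B ij.
have mi := measurable_increment i; have mj := measurable_increment j.
have ii := integrable_increment i; have ij' := integrable_increment j.
split; first exact: (integrable_indep_mul P _ _ mi mj h ii ij').
rewrite (integral_indep_mul P _ _ mi mj h ii ij').
by rewrite expectation_increment mul0e mulr0.
Qed.

Lemma centred_increment_product i j :
  P.-integrable setT (fun w => (cov i j w)%:E) /\ (\int[P]_w (cov i j w)%:E = 0)%E.
Proof.
have [ic cE] := increment_product i j.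
have icst : P.-integrable setT (fun=> ((t - s) * (i == j)%:R)%:E).
  exact: finite_measure_integrable_cst.
split; first by under eq_fun do rewrite EFinB; exact: integrableB.
under eq_integral do rewrite EFinB.
rewrite integralB// cE integral_cst//= probability_setT mule1 subee//.
Qed.

(** The increment is independent of [F s].  Multiplying [Y] by the indicator of
    an event [A] of [F s] keeps it a function of the past, so the product
    formula for expectations applies on [A] as well. *)
Lemma integral_past_increment (Y : Omega -> R) (phi : 'cV[R]_m -> R) :
  measurable_fun [set: Fs] (Y : Fs -> R) -> P.-integrable setT (EFin \o Y) ->
  continuous phi -> measurable_fun setT (phi \o dW) ->
  P.-integrable setT (EFin \o phi \o dW) ->
  (\int[P]_w (phi (dW w))%:E = 0)%E ->
  P.-integrable setT (fun w => (Y w * phi (dW w))%:E) /\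
  forall A, F s A -> (\int[P]_(w in A) (Y w * phi (dW w))%:E = 0)%E.
Proof.
move=> mY iY cphi mphi iphi Ephi.
have FM := filtration_measurable hF s0.
have key (Y' : Omega -> R) : measurable_fun [set: Fs] (Y' : Fs -> R) ->
    P.-integrable setT (EFin \o Y') ->
    P.-integrable setT (fun w => (Y' w * phi (dW w))%:E) /\
    (\int[P]_w (Y' w * phi (dW w))%:E = 0)%E.
  move=> mY' iY'.
  have mY'P := measurable_fun_sub_sigma _ _ FM mY'.
  have ind A B : measurable A -> measurable B ->
      P (Y' @^-1` A `&` (phi \o dW) @^-1` B) =
      (P (Y' @^-1` A) * P ((phi \o dW) @^-1` B))%E.
    move=> mA mB.
    have FA : F s (Y' @^-1` A).
      rewrite -(sigma_algebra_id (filtration_sigma hF s0)).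
      by have := mY' measurableT A mA; rewrite setTI.
    exact: (brownian_indep hW s0 st FA (borel_continuous_preimage _ _ cphi mB)).
  split; first exact: (integrable_indep_mul P _ _ mY'P mphi ind iY' iphi).
  by rewrite (integral_indep_mul P _ _ mY'P mphi ind iY' iphi) Ephi mule0.
split; first by have [] := key _ mY iY.
move=> A FA; have mA : measurable A by exact: FM.
have [] := key (fun w => Y w * \1_A w).
- apply: measurable_funM => //.
  by apply: measurable_indic; exact: sub_sigma_algebra.
- apply: (le_integrable measurableT _ _ iY).
    apply/measurable_EFinP/measurable_funM; last exact: measurable_indic.
    exact: (measurable_fun_sub_sigma _ _ FM mY).
  move=> w _ /=; rewrite lee_fin normrM ler_piMr//.
  by rewrite indicE; case: (_ \in _); rewrite ?normr1 ?normr0.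
move=> _ E0; rewrite integral_mkcond -[RHS]E0.
apply: eq_integral => w _; rewrite patchE indicE.
by case: (_ \in _); rewrite ?mulr1// mulr0 mul0r.
Qed.

End brownian_increment.

(** With [h] the Brownian increment over a step of length [D], this is the
    martingale increment [|x + g h|^2 - |x|^2 - D |g|^2]. *)
Definition noise {R : realType} {d m : nat} (D : R) (x : 'cV[R]_d)
    (g : 'M[R]_(d, m)) (h : 'cV[R]_m) : R :=
  2 * dotv x (g *m h) + enorm (g *m h) ^+ 2 - D * trnorm g ^+ 2.

(** Each summand is a product of a function of [x] and [g], which are known
    before the step, and of a centred function of the increment. *)
Lemma noiseE {R : realType} {d m : nat} (D : R) (x : 'cV[R]_d)
    (g : 'M[R]_(d, m)) (h : 'cV[R]_m) :
  noise D x g h =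
  \sum_(b < m) (2 * \sum_(a < d) x a 0 * g a b) * h b 0 +
  \sum_(p : 'I_m * 'I_m) (\sum_(a < d) g a p.1 * g a p.2) *
    (h p.1 0 * h p.2 0 - D * (p.1 == p.2)%:R).
Proof.
rewrite /noise -addrA; congr (_ + _).
  rewrite /dotv mulr_sumr.
  under eq_bigr do rewrite mxE mulr_sumr mulr_sumr.
  rewrite exchange_big; apply: eq_bigr => b _ /=.
  rewrite mulr_sumr mulr_suml; apply: eq_bigr => a _; ring.
under [RHS]eq_bigr do rewrite mulrBr.
rewrite sumrB; congr (_ - _).
  rewrite sqr_enormE -(pair_bigA _ (fun b c =>
    (\sum_(a < d) g a b * g a c) * (h b 0 * h c 0)))/=.
  under eq_bigr => a _ do rewrite mxE expr2 mulr_suml.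
  rewrite exchange_big; apply: eq_bigr => b _ /=.
  under eq_bigr => a _ do rewrite mulr_sumr.
  rewrite exchange_big; apply: eq_bigr => c _ /=.
  rewrite mulr_suml; apply: eq_bigr => a _; ring.
rewrite sqr_trnormE mulr_sumr.
rewrite -(pair_bigA _ (fun b c =>
  (\sum_(a < d) g a b * g a c) * (D * (b == c)%:R)))/=.
apply: eq_bigr => b _; rewrite (bigD1 b)//= eqxx mulr1.
rewrite [X in _ = _ + X]big1 ?addr0; last first.
  by move=> c; rewrite eq_sym => /negbTE ->; rewrite !mulr0.
by rewrite mulrC; congr (_ * _); apply: eq_bigr => a _; rewrite expr2.
Qed.

Lemma noise_linear_coef {R : realType} {d m : nat} (x : 'cV[R]_d)
    (g : 'M[R]_(d, m)) b :
  `|2 * \sum_(a < d) x a 0 * g a b| <= enorm x ^+ 2 + trnorm g ^+ 2.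
Proof.
have gb : \sum_(a < d) g a b ^+ 2 <= trnorm g ^+ 2.
  rewrite sqr_trnormE (bigD1 b)//= lerDl sumr_ge0// => c _.
  by apply: sumr_ge0 => a _; exact: sqr_ge0.
apply: (@le_trans _ _ (enorm x ^+ 2 + \sum_(a < d) g a b ^+ 2)); last first.
  by rewrite lerD2l.
rewrite sqr_enormE -big_split/= mulr_sumr (le_trans (ler_norm_sum _ _ _))//.
apply: ler_sum => a _; rewrite ler_norml.
have := sqr_ge0 (x a 0 - g a b); have := sqr_ge0 (x a 0 + g a b).
by move=> ? ?; apply/andP; split; nra.
Qed.

Lemma noise_quadratic_coef {R : realType} {d m : nat} (g : 'M[R]_(d, m)) b c :
  `|\sum_(a < d) g a b * g a c| <= trnorm g ^+ 2.
Proof.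
have gb e : \sum_(a < d) g a e ^+ 2 <= trnorm g ^+ 2.
  rewrite sqr_trnormE (bigD1 e)//= lerDl sumr_ge0// => k _.
  by apply: sumr_ge0 => a _; exact: sqr_ge0.
rewrite -(@ler_pM2l _ 2)// -[leLHS]/(2 * _).
apply: (@le_trans _ _
  (\sum_(a < d) g a b ^+ 2 + \sum_(a < d) g a c ^+ 2)); last first.
  by rewrite mulr_natl mulr2n lerD.
rewrite -big_split/=.
apply: (@le_trans _ _ (\sum_(a < d) 2 * `|g a b * g a c|)).
  by rewrite -mulr_sumr ler_pM2l// ler_norm_sum.
apply: ler_sum => a _; rewrite -[2]ger0_norm// -normrM ler_norml.
have := sqr_ge0 (g a b - g a c); have := sqr_ge0 (g a b + g a c).
by move=> ? ?; apply/andP; split; nra.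
Qed.

Section noise_integral.
Context {R : realType} {disp : measure_display} {Omega : measurableType disp}.
Context (P : probability Omega R) (F : R -> set (set Omega)).
Hypothesis hF : filtration_usual P F.
Context {d m : nat} (W : R -> Omega -> 'cV[R]_m).
Hypothesis hW : brownian_motion P F W.
Context (s t : R) (s0 : 0 <= s) (st : s < t).
Local Notation Fs := (g_sigma_algebraType (F s)).
Context (x : Omega -> 'cV[R]_d) (g : Omega -> 'M[R]_(d, m)).
Hypothesis mx : @measurable_mx _ Fs R _ _ x.
Hypothesis mg : @measurable_mx _ Fs R _ _ g.
Hypothesis ix : P.-integrable setT (fun w => (enorm (x w) ^+ 2)%:E).
Hypothesis ig : P.-integrable setT (fun w => (trnorm (g w) ^+ 2)%:E).

Local Notation dW := (fun w => W t w - W s w).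

Let centred (Z : Omega -> R) : Prop :=
  P.-integrable setT (fun w => (Z w)%:E) /\
  forall A, F s A -> (\int[P]_(w in A) (Z w)%:E = 0)%E.

Let centred_sum (I : finType) (Z : I -> Omega -> R) :
  (forall i, centred (Z i)) -> centred (fun w => \sum_i Z i w).
Proof.
move=> cZ; split.
  under eq_fun do rewrite -sumEFin.
  by apply: integrable_sum => // i _; have [] := cZ i.
move=> A FA; have mA : measurable A by exact: (filtration_measurable hF s0).
under eq_integral do rewrite -sumEFin.
rewrite integral_sum//; last first.
  by move=> i; apply: (integrableS measurableT) => //; have [] := cZ i.
by rewrite big1// => i _; have [_ ->] := cZ i.
Qed.

Let centredD (Y Z : Omega -> R) : centred Y -> centred Z ->
  centred (fun w => Y w + Z w).
Proof.
move=> [iY Y0] [iZ Z0]; split.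
  by under eq_fun do rewrite EFinD; exact: integrableD.
move=> A FA; have mA : measurable A by exact: (filtration_measurable hF s0).
under eq_integral do rewrite EFinD.
rewrite integralD//; [|exact: (integrableS measurableT)..].
by rewrite Y0// Z0// adde0.
Qed.

Let coordW i : continuous (fun h : 'cV[R]_m => h i 0).
Proof. by move=> h; exact: coord_continuous. Qed.

(** Being square integrable is the right assumption on [x] and [g]: the
    coefficients in [noiseE] are bounded by [|x|^2 + |g|^2]. *)
Lemma integral_noise :
  P.-integrable setT (fun w => (noise (t - s) (x w) (g w) (dW w))%:E) /\
  forall A, F s A ->
    (\int[P]_(w in A) (noise (t - s) (x w) (g w) (dW w))%:E = 0)%E.
Proof.
suff : centred (fun w => noise (t - s) (x w) (g w) (dW w)) by [].
rewrite (_ : (fun w => _) = fun w =>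
  \sum_(b < m) (2 * \sum_(a < d) x w a 0 * g w a b) * dW w b 0 +
  \sum_(p : 'I_m * 'I_m) (\sum_(a < d) g w a p.1 * g w a p.2) *
    (dW w p.1 0 * dW w p.2 0 - (t - s) * (p.1 == p.2)%:R)); last first.
  by apply/funext => w; rewrite noiseE.
have FM := filtration_measurable hF s0.
have mdW := measurable_increment P F hF W hW s t s0 st.
apply: centredD; [apply: centred_sum => b|apply: centred_sum => -[b c]].
  pose Y w := 2 * \sum_(a < d) x w a 0 * g w a b.
  have mY : measurable_fun [set: Fs] (Y : Fs -> R).
    apply: measurable_funM => //; apply: measurable_sum => a.
    exact: measurable_funM.
  apply: (integral_past_increment P F hF W hW s t s0 st Y (fun h => h b 0)) => //.
  - apply: (le_integrable measurableT _ _ (integrableD measurableT ix ig)) => //.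
      by apply/measurable_EFinP; exact: (measurable_fun_sub_sigma _ _ FM mY).
    move=> w _ /=; rewrite lee_fin [leRHS]ger0_norm ?addr_ge0 ?sqr_ge0//.
    exact: noise_linear_coef.
  - exact: mdW.
  - exact: (integrable_increment P F hF W hW s t s0 st b).
  - exact: (expectation_increment P F hF W hW s t s0 st b).
pose Y w := \sum_(a < d) g w a b * g w a c.
have mY : measurable_fun [set: Fs] (Y : Fs -> R).
  by apply: measurable_sum => a; exact: measurable_funM.
have [iC C0] := centred_increment_product P F hF W hW s t s0 st b c.
apply: (integral_past_increment P F hF W hW s t s0 st Y
  (fun h => h b 0 * h c 0 - (t - s) * (b == c)%:R)) => //.
- apply: (le_integrable measurableT _ _ ig).
    by apply/measurable_EFinP; exact: (measurable_fun_sub_sigma _ _ FM mY).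
  move=> w _ /=; rewrite lee_fin [leRHS]ger0_norm ?sqr_ge0//.
  exact: noise_quadratic_coef.
- have c1 : continuous (fun h : 'cV[R]_m => h b 0 * h c 0).
    move=> h; apply: (continuousM (coordW b h) (coordW c h)).
  have c2 : continuous (fun x : R => x - (t - s) * (b == c)%:R).
    by move=> y; apply: (@cvgB _ R^o); [exact: cvg_id|exact: cvg_cst].
  by move=> h; exact: (continuous_comp (c1 h) (c2 _)).
- by apply: measurable_funB => //; exact: measurable_funM.
Qed.

End noise_integral.

(** * A maximal inequality for dissipative processes *)

(** Markov's inequality on the part of [C] where [U] exceeds [l]. *)
Lemma level_set_split {d} {T : measurableType d} {R : realType}
    (P : {measure set T -> \bar R}) (U : T -> R) (C : set T) (l : R) :
  measurable C -> measurable_fun setT U -> (forall w, 0 <= U w) -> 0 <= l ->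
  (\int[P]_(w in C `&` [set w | (U w <= l)%R]) (U w)%:E +
     l%:E * P (C `&` [set w | (l < U w)%R]) <= \int[P]_(w in C) (U w)%:E)%E.
Proof.
move=> mC mU U0 l0.
have mle : measurable [set w | U w <= l].
  rewrite -[X in measurable X]setTI.
  rewrite (_ : [set w | U w <= l] = U @^-1` `]-oo, l]%classic); first exact: mU.
  by apply/seteqP; split => w /=; rewrite in_itv.
have mgt : measurable [set w | l < U w].
  rewrite -[X in measurable X]setTI.
  rewrite (_ : [set w | l < U w] = U @^-1` `]l, +oo[%classic); first exact: mU.
  by apply/seteqP; split => w /=; rewrite in_itv/= andbT.
have mUE D : measurable_fun D (fun w => (U w)%:E).
  by apply/measurable_EFinP; exact: measurable_funTS.
rewrite [in leRHS](_ : C =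
  (C `&` [set w | U w <= l]) `|` (C `&` [set w | l < U w])); last first.
  apply/seteqP; split => [w Cw|w [[]|[]]//].
  by case: (leP (U w) l) => ?; [left|right].
rewrite ge0_integral_setU//.
- rewrite leeD2l// -integral_cst; last exact: measurableI.
  apply: ge0_le_integral => //.
  + exact: measurableI.
  + by move=> w [_ /= lU]; rewrite lee_fin ltW.
- exact: measurableI.
- exact: measurableI.
- by move=> w _; rewrite lee_fin.
- apply/disj_setPS => w [[_ /= h] [_ /=]].
  by rewrite ltNge h.
Qed.

Section dissipative_process.
Context {R : realType} {disp : measure_display} {Omega : measurableType disp}.
Context (P : probability Omega R) (G : nat -> set (set Omega)).
Hypothesis Gsig : forall n, sigma_algebra setT (G n).
Hypothesis Gmeas : forall n, G n `<=` measurable.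
Hypothesis Gmono : forall n, G n `<=` G n.+1.
Context (U D : nat -> Omega -> R).
Hypothesis U_ge0 : forall n w, 0 <= U n w.
Hypothesis mU : forall n,
  measurable_fun [set: g_sigma_algebraType (G n)]
    (U n : g_sigma_algebraType (G n) -> R).
Context (rho c K : R).
Hypothesis rho1 : 1 <= rho.
Hypothesis c_ge0 : 0 <= c.
Hypothesis cK : c <= (rho - 1) * K.
Hypothesis U0K : forall w, U 0 w <= K.
Hypothesis step : forall n w, rho * U n.+1 w <= U n w + c + D n w.
Hypothesis centredD : forall n, P.-integrable setT (fun w => (U n w)%:E) ->
  P.-integrable setT (fun w => (D n w)%:E) /\
  forall A, G n A -> (\int[P]_(w in A) (D n w)%:E = 0)%E.

Let mUP n : measurable_fun [set: Omega] (U n).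
Proof. exact: (measurable_fun_sub_sigma _ _ (@Gmeas n) (mU n)). Qed.

Let GT n : G n setT.
Proof. by have [G0 GC _] := Gsig n; rewrite -(setD0 setT); exact: GC. Qed.

Let integral_step n A : G n A -> P.-integrable setT (fun w => (U n w)%:E) ->
  P.-integrable setT (fun w => (U n w + c + D n w)%:E) /\
  (\int[P]_(w in A) (U n w + c + D n w)%:E =
     \int[P]_(w in A) (U n w)%:E + c%:E * P A)%E.
Proof.
move=> GA iU; have [iD D0] := centredD n iU.
have mA : measurable A by exact: Gmeas GA.
have ic : P.-integrable setT (fun=> c%:E) by exact: finite_measure_integrable_cst.
split.
  under eq_fun do rewrite EFinD EFinD.
  by apply: integrableD => //; exact: integrableD.
under eq_integral do rewrite EFinD EFinD.
rewrite integralD//; last 2 first.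
- by apply: (integrableS measurableT) => //; exact: integrableD.
- exact: (integrableS measurableT).
rewrite D0// adde0 integralD//; [|exact: (integrableS measurableT)..].
by rewrite integral_cst.
Qed.

(** The level [K] is preserved because it is at least [c / (rho - 1)], the fixed
    point of the recursion [rho u' = u + c].  Integrability has to be carried
    along: the noise of step [n] is integrable only once [U n] is. *)
Lemma dissipative_expectation n :
  P.-integrable setT (fun w => (U n w)%:E) /\ (\int[P]_w (U n w)%:E <= K%:E)%E.
Proof.
elim: n => [|n [iU EU]].
  have iK : P.-integrable setT (fun=> K%:E) by exact: finite_measure_integrable_cst.
  have i0 : P.-integrable setT (fun w => (U 0 w)%:E).
    apply: (le_integrable measurableT _ _ iK); first exact/measurable_EFinP.
    by move=> w _ /=; rewrite lee_fin !ger0_norm// (le_trans (U_ge0 0 w)).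
  split=> //; apply: (@le_trans _ _ (\int[P]_w K%:E)%E).
    by apply: le_integral => // w _; rewrite lee_fin.
  by rewrite integral_cst//= probability_setT mule1.
have [iS SE] := integral_step n setT (GT n) iU.
have iU1 : P.-integrable setT (fun w => (U n.+1 w)%:E).
  apply: (le_integrable measurableT _ _ iS); first exact/measurable_EFinP.
  move=> w _ /=; rewrite lee_fin (ger0_norm (U_ge0 _ _)).
  apply: le_trans (ler_norm _); apply: le_trans (step n w).
  by rewrite ler_peMl.
split=> //.
have rho0 : 0 < rho by rewrite (lt_le_trans ltr01).
rewrite -(@lee_pmul2l _ rho%:E)// -integralZl//.
apply: (@le_trans _ _ (\int[P]_w (U n w + c + D n w)%:E)%E).
  apply: le_integral => //; first exact: integrableZl.
  by move=> w _; rewrite -EFinM lee_fin.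
rewrite SE/= probability_setT mule1 -EFinM.
apply: (@le_trans _ _ (K%:E + c%:E)%E); first by rewrite leeD2r.
by rewrite -EFinD lee_fin; have := cK; rewrite mulrBl mul1r; lra.
Qed.

(** Doob's argument without conditional expectations: on the event [B i] that
    the level has not been exceeded up to [k + i], which belongs to the past, one
    step costs at most [c], and what leaves [B i] leaves it above level [l]. *)
Lemma dissipative_maximal (k N : nat) (l : R) : 0 <= l ->
  (l%:E * P (~` [set w | forall j, (j <= N)%N -> (U (k + j) w <= l)%R]) <=
   (K + c *+ N)%:E)%E.
Proof.
move=> l0.
pose B N := [set w | forall j, (j <= N)%N -> U (k + j) w <= l].
have BS i : B i.+1 = B i `&` [set w | U (k + i.+1) w <= l].
  apply/seteqP; split=> w /=.
    by move=> h; split=> [j ji|]; apply: h => //; exact: leqW.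
  by move=> [h h1] j; rewrite leq_eqVlt ltnS => /predU1P[->//|]; exact: h.
have GU n : G n [set w | U n w <= l].
  rewrite -(sigma_algebra_id (Gsig n)).
  rewrite (_ : [set w | _] = U n @^-1` `]-oo, l]%classic); last first.
    by apply/seteqP; split => w /=; rewrite in_itv.
  have := mU n measurableT `]-oo, l]%classic.
  by rewrite setTI; apply; exact: measurable_itv.
have GB i : G (k + i)%N (B i).
  elim: i => [|i IH].
    rewrite (_ : B 0%N = [set w | U (k + 0) w <= l])//.
    apply/seteqP; split => w /=; first by move=> /(_ 0%N); exact.
    by move=> h j; rewrite leqn0 => /eqP ->.
  rewrite BS -(sigma_algebra_id (Gsig _)).
  apply: (@measurableI _ (g_sigma_algebraType (G (k + i.+1)))).
    by apply: sub_sigma_algebra; rewrite addnS; exact: Gmono.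
  by apply: sub_sigma_algebra; exact: GU.
have mB i : measurable (B i) by exact: Gmeas (GB i).
suff main i : (\int[P]_(w in B i) (U (k + i) w)%:E + l%:E * P (~` B i) <=
    (K + c *+ i)%:E)%E.
  apply: le_trans (main N); rewrite leeDr//.
  by apply: integral_ge0 => w _; rewrite lee_fin.
elim: i => [|i IH].
  rewrite mulr0n addr0; have [_] := dissipative_expectation (k + 0); apply: le_trans.
  apply: le_trans (level_set_split P (U (k + 0)%N) setT l measurableT
    (mUP _) (U_ge0 _) l0).
  rewrite !setTI (_ : B 0%N = [set w | U (k + 0) w <= l]).
    rewrite (_ : ~` _ = [set w | l < U (k + 0)%N w])//.
    by apply/seteqP; split => w /=; rewrite ltNge => /negP.
  apply/seteqP; split => w /=; first by move=> /(_ 0%N); exact.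
  by move=> h j; rewrite leqn0 => /eqP ->.
have [iU _] := dissipative_expectation (k + i).
have [iS SE] := integral_step _ _ (GB i) iU.
have [iU1 _] := dissipative_expectation (k + i).+1.
rewrite BS addnS.
have -> : (P (~` (B i `&` [set w | (U (k + i).+1 w <= l)%R])) =
    P (B i `&` [set w | (l < U (k + i).+1 w)%R]) + P (~` B i))%E.
  rewrite -measureU//.
  - congr (P _); apply/seteqP; split => w /=.
      case: (pselect (B i w)) => Bw h; last by right.
      by left; split => //; rewrite ltNge; apply/negP => h'; apply: h.
    by move=> [[Bw lU] [_ Ul]|nB [Bw _]//]; move: lU; rewrite ltNge Ul.
  - apply: measurableI => //.
    rewrite (_ : [set w | _] = ~` [set w | U (k + i).+1 w <= l]).
      by apply: measurableC; exact: Gmeas (GU _).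
    by apply/seteqP; split => w /=; rewrite ltNge => /negP.
  - exact: measurableC.
  - by rewrite -setIA [X in _ `&` X]setIC setIA setICr set0I.
rewrite ge0_muleDr// addeA.
apply: (@le_trans _ _ (\int[P]_(w in B i) (U (k + i).+1 w)%:E +
  l%:E * P (~` B i))%E).
  by rewrite leeD2r//; exact: level_set_split.
apply: (@le_trans _ _ (\int[P]_(w in B i) (U (k + i) w + c + D (k + i) w)%:E +
  l%:E * P (~` B i))%E).
  rewrite leeD2r//; apply: le_integral => //.
  - exact: (integrableS measurableT).
  - exact: (integrableS measurableT).
  - move=> w _; rewrite lee_fin; apply: le_trans (step _ _).
    by rewrite ler_peMl.
rewrite SE addeAC mulrSr addrA EFinD leeD//.
by rewrite -[leRHS]mule1; apply: lee_wpmul2l => //; exact: probability_le1.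
Qed.

End dissipative_process.

(** * One step of the implicit scheme *)

(** In [|z|^2 - |x|^2 = 2 <z, z - x> - |z - x|^2] the last term pays for replacing
    [z] by [x] in the inner product with [v]. *)
Lemma implicit_euler_energy {R : realType} {d : nat} (D : R) (x z F v : 'cV[R]_d) :
  z = x + D *: F + v ->
  enorm z ^+ 2 <= enorm x ^+ 2 + D * (2 * dotv z F) + 2 * dotv x v + enorm v ^+ 2.
Proof.
move=> zE; have := ler_dotv_enorm (z - x) v.
have : dotv z (z - x) = D * dotv z F + dotv z v.
  have -> : z - x = D *: F + v by rewrite zE addrC !addrA addNr add0r.
  by rewrite dotvDr dotvZr.
rewrite !sqr_enorm !(dotvDl, dotvDr, dotvNl, dotvNr) (dotvC x z); lra.
Qed.

(** The one-sided Lipschitz condition makes [x] a Lipschitz function of the data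
    [z] and [y], whatever the growth of [f]. *)
Lemma implicit_euler_stability {R : realType} {d : nat}
    (f : 'cV[R]_d -> 'cV[R]_d -> 'cV[R]_d) (D b : R) (x x' y y' z z' : 'cV[R]_d) :
  0 <= D ->
  2 * dotv (x - x') (f x y - f x' y') <= b * enorm (y - y') ^+ 2 ->
  x = z + D *: f x y -> x' = z' + D *: f x' y' ->
  enorm (x - x') ^+ 2 <= enorm (z - z') ^+ 2 + D * b * enorm (y - y') ^+ 2.
Proof.
move=> D0 hf xE x'E.
have : dotv (x - x') (x - x') =
    dotv (x - x') (z - z') + D * dotv (x - x') (f x y - f x' y').
  rewrite -dotvZr -dotvDr; congr dotv.
  by rewrite {1}xE {1}x'E scalerBr opprD addrACA.
have := ler_dotv_enorm (x - x') (z - z').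
have := ler_wpM2l D0 hf.
rewrite -(sqr_enorm (x - x')); lra.
Qed.

Section discounted_memory.
Context {R : realType} (a : nat -> R) (rho : R) (M : nat).

(** The recent past weighs most, by the factor [rho ^+ M.-1], and the weight of
    a value is divided by [rho] at each step, until it is forgotten after [M]
    steps. *)
Definition discounted_memory (i : nat) : R :=
  \sum_(l < M) rho ^+ l * a (i + l).+1.

Lemma discounted_memory_step i :
  rho * discounted_memory i.+1 + a i.+1 =
  discounted_memory i + rho ^+ M * a (i + M).+1.
Proof.
rewrite /discounted_memory.
transitivity (\sum_(l < M.+1) rho ^+ l * a (i + l).+1); last by rewrite big_ord_recr.
rewrite big_ord_recl addn0 expr0 mul1r addrC; congr (_ + _).
rewrite mulr_sumr; apply: eq_bigr => l _.
by rewrite mulrA -exprS /= /bump /= addSnnS.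
Qed.

End discounted_memory.

(** [C] is the worst ratio of the weights in the memory over one delay interval.
    It must be close to 1 for the gaps [b10 - b11] and [b12 - b13] to absorb it,
    uniformly in [M]; this holds with [C = 1 + k] and
    [lam <= ln (1 + k) / tau]. *)
Lemma discount_rate {R : realType} (tau b10 b11 b12 b13 l2 : R) :
  0 < tau -> 0 <= b11 -> 0 <= b13 -> b11 < b10 -> b13 < b12 -> 1 < l2 ->
  exists lam C : R, [/\ 0 < lam, lam + C * b11 <= b10, C * b13 <= b12,
    1 + lam * tau <= l2 &
    forall M, (0 < M)%N -> (1 + lam * (tau / M%:R)) ^+ M <= C].
Proof.
move=> t0 b11_0 b13_0 b1110 b1312 l21.
pose k := Num.min ((b10 - b11) / (1 + b11)) ((b12 - b13) / (1 + b13)).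
have k0 : 0 < k by rewrite lt_min !divr_gt0 ?subr_gt0// ltr_wpDr.
pose lam := Num.min k (Num.min (ln (1 + k) / tau) ((l2 - 1) / tau)).
have lam0 : 0 < lam.
  by rewrite /lam lt_min k0 lt_min !divr_gt0 ?subr_gt0// ln_gt0// ltrDl.
have lamk : lam <= k by rewrite /lam ge_min lexx.
have lamln : lam * tau <= ln (1 + k).
  by rewrite -ler_pdivlMr// /lam !ge_min lexx orbT.
have laml : lam * tau <= l2 - 1.
  by rewrite -ler_pdivlMr// /lam !ge_min lexx !orbT.
have k1 : k * (1 + b11) <= b10 - b11.
  by rewrite -ler_pdivlMr ?ltr_wpDr// /k ge_min lexx.
have k2 : k * (1 + b13) <= b12 - b13.
  by rewrite -ler_pdivlMr ?ltr_wpDr// /k ge_min lexx orbT.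
exists lam, (1 + k); split => //; [nra|nra|lra|].
move=> M M0; have M0' : 0 < (M%:R : R) by rewrite ltr0n.
apply: (@le_trans _ _ (expR (lam * (tau / M%:R)) ^+ M)).
  apply: lerXn2r; rewrite ?nnegrE ?expR_ge0//; last exact: expR_ge1Dx.
  by rewrite addr_ge0// mulr_ge0// ?divr_ge0// ltW.
rewrite -expRM_natr mulrA divfK ?gt_eqF//.
by rewrite -[leRHS]lnK ?ler_expR// posrE addr_gt0.
Qed.

Section lyapunov.
Context {R : realType} {d m : nat} (f : 'cV[R]_d -> 'cV[R]_d -> 'cV[R]_d)
  (g : 'cV[R]_d -> 'cV[R]_d -> 'M[R]_(d, m)).
Context (q b9 b10 b11 b12 b13 l2 : R).
Hypothesis diss : forall x y,
    2 * dotv x (f x y) + l2 * trnorm (g x y) ^+ 2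
      <= b9 - b10 * enorm x ^+ 2 + b11 * enorm y ^+ 2
            - b12 * enorm x `^ (q + 1) + b13 * enorm y `^ (q + 1).
Hypotheses (b11_ge0 : 0 <= b11) (b13_ge0 : 0 <= b13).
Context (D lam C : R) (M : nat).
Hypotheses (D0 : 0 <= D) (lam_ge0 : 0 <= lam).
Let rho := 1 + lam * D.
Hypotheses (rhoC : rho ^+ M <= C) (lamC : lam + C * b11 <= b10)
  (Cb : C * b13 <= b12) (rhol : rho <= l2).

Definition delay_weight (x : 'cV[R]_d) : R :=
  b11 * enorm x ^+ 2 + b13 * enorm x `^ (q + 1).

(** Here [y (i + M)] is the value at time [i D] and [y i] the one a delay earlier:
    the index of [y] counts the steps from the beginning of the initial
    segment. *)
Definition lyapunov (y : nat -> 'cV[R]_d) (i : nat) : R :=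
  enorm (y (i + M)%N) ^+ 2 + D * trnorm (g (y (i + M)%N) (y i)) ^+ 2 +
  D * discounted_memory (fun j => delay_weight (y j)) (1 + lam * D) M i.

Lemma delay_weight_ge0 x : 0 <= delay_weight x.
Proof. by rewrite addr_ge0// mulr_ge0// ?sqr_ge0 ?powR_ge0. Qed.

Lemma le_lyapunov y i : enorm (y (i + M)%N) ^+ 2 <= lyapunov y i.
Proof.
rewrite /lyapunov -addrA lerDl addr_ge0// mulr_ge0// ?sqr_ge0//.
apply: sumr_ge0 => l _; rewrite mulr_ge0 ?delay_weight_ge0// exprn_ge0//.
by rewrite addr_ge0// mulr_ge0.
Qed.

Lemma lyapunov_ge0 y i : 0 <= lyapunov y i.
Proof. exact: le_trans (sqr_ge0 _) (le_lyapunov y i). Qed.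

Lemma le_lyapunov_diffusion y i :
  D * trnorm (g (y (i + M)%N) (y i)) ^+ 2 <= lyapunov y i.
Proof.
rewrite /lyapunov addrAC lerDr addr_ge0// ?sqr_ge0// mulr_ge0//.
apply: sumr_ge0 => l _; rewrite mulr_ge0 ?delay_weight_ge0// exprn_ge0//.
by rewrite addr_ge0// mulr_ge0.
Qed.

(** The three terms of the functional grow by the factor [rho] in one step.  For
    the squared norm this costs [D lam |z|^2], for the diffusion term [rho <= l2]
    is what the dissipativity condition allows, and for the memory the new value
    enters with weight [rho ^+ M <= C] while the value leaving it cancels the
    delayed terms. *)
Lemma lyapunov_noise_step (y : nat -> 'cV[R]_d) (h : nat -> 'cV[R]_m) i :
  y (i + M).+1 = y (i + M)%N + D *: f (y (i + M).+1) (y i.+1)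
                 + g (y (i + M)%N) (y i) *m h i ->
  rho * lyapunov y i.+1 <= lyapunov y i + D * b9 +
    noise D (y (i + M)%N) (g (y (i + M)%N) (y i)) (h i).
Proof.
move=> /implicit_euler_energy; rewrite /lyapunov /noise addSn.
have := discounted_memory_step (fun j => delay_weight (y j)) (1 + lam * D) M i.
set Q1 := discounted_memory _ _ _ i.+1; set Q0 := discounted_memory _ _ _ i.
rewrite -/rho /delay_weight.
have := diss (y (i + M).+1) (y i.+1).
set z := y (i + M).+1; set x := y (i + M)%N.
set ez := enorm z `^ (q + 1); set n := enorm z ^+ 2.
have n0 : 0 <= n := sqr_ge0 _.
have ez0 : 0 <= ez := powR_ge0 _ _.
set G := trnorm (g z _) ^+ 2; have G0 : 0 <= G := sqr_ge0 _.
move=> /(ler_wpM2l D0) hd; move: (rho ^+ M) rhoC => rM rC hQ hE.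
have h1 : D * (rM * (b11 * n + b13 * ez)) <= D * ((b10 - lam) * n + b12 * ez).
  have c11 : rM * b11 <= b10 - lam.
    by rewrite lerBrDr; apply: le_trans lamC; rewrite addrC lerD2l ler_wpM2r.
  have c13 : rM * b13 <= b12.
    by apply: le_trans Cb; rewrite ler_wpM2r.
  have := ler_wpM2r n0 c11; have := ler_wpM2r ez0 c13 => ? ?.
  by rewrite ler_wpM2l//; lra.
have h2 : rho * (D * G) <= l2 * (D * G) by rewrite ler_wpM2r// mulr_ge0.
have hQ' : rho * (D * Q1) = D * Q0 + D * (rM * (b11 * n + b13 * ez))
   - D * (b11 * enorm (y i.+1) ^+ 2 + b13 * enorm (y i.+1) `^ (q + 1)).
  by rewrite mulrCA -!mulrDr -mulrBr -hQ; congr (_ * _); rewrite addrK.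
rewrite !mulrDr hQ'.
have hn : rho * n = n + D * (lam * n) by rewrite /rho; ring.
rewrite hn; lra.
Qed.

Context (a7 a8 a9 r tau : R).
Hypotheses (a7_ge0 : 0 <= a7) (a8_ge0 : 0 <= a8) (a9_ge0 : 0 <= a9).
Hypothesis g_growth : forall x y,
  trnorm (g x y) ^+ 2 <= a7 + a8 * enorm x `^ (q + 1) + a9 * enorm y `^ (q + 1).
Hypotheses (q_ge0 : 0 <= q) (r_ge0 : 0 <= r) (M_gt0 : (0 < M)%N)
  (tauE : M%:R * D = tau).

Definition lyapunov_bound : R :=
  r ^+ 2 + tau * (a7 + a8 * r `^ (q + 1) + a9 * r `^ (q + 1)) +
  tau * (C * (b11 * r ^+ 2 + b13 * r `^ (q + 1))).

Lemma lyapunov0_le (y : nat -> 'cV[R]_d) :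
  (forall j, (j <= M)%N -> enorm (y j) <= r) -> lyapunov y 0 <= lyapunov_bound.
Proof.
move=> yr.
have rho1 : 1 <= rho by rewrite lerDl mulr_ge0.
have pr j : (j <= M)%N -> enorm (y j) `^ (q + 1) <= r `^ (q + 1).
  move=> jM; rewrite ge0_ler_powR ?nnegrE ?enorm_ge0 ?addr_ge0//.
  exact: yr.
have sr j : (j <= M)%N -> enorm (y j) ^+ 2 <= r ^+ 2.
  by move=> jM; rewrite lerXn2r ?nnegrE ?enorm_ge0// yr.
have Dtau : D <= tau.
  by rewrite -tauE ler_peMl// ler1n.
have tau_ge0 : 0 <= tau by rewrite (le_trans D0).
rewrite /lyapunov /lyapunov_bound !lerD ?sr//.
  apply: ler_pM => //; rewrite ?sqr_ge0//.
  apply: le_trans (g_growth _ _) _.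
  by rewrite !lerD// ler_wpM2l// pr.
rewrite -tauE -mulrA mulrCA ler_wpM2l//.
have -> : M%:R * (C * (b11 * r ^+ 2 + b13 * r `^ (q + 1))) =
  \sum_(l < M) C * (b11 * r ^+ 2 + b13 * r `^ (q + 1)).
  by rewrite sumr_const card_ord mulr_natl.
apply: ler_sum => l _.
apply: ler_pM; rewrite ?delay_weight_ge0//.
- by rewrite exprn_ge0// (le_trans ler01).
- by apply: le_trans rhoC; apply: ler_weXn2l => //; exact: ltnW.
- have lM : ((0 + l).+1 <= M)%N by rewrite add0n.
  by apply: lerD; apply: ler_wpM2l => //; [exact: sr|exact: pr].
Qed.

End lyapunov.

(** * The numerical solution on the grid *)

Lemma enorm_le_coord {R : realType} {d : nat} (x : 'cV[R]_d) (e : R) :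
  (forall i, `|x i 0| <= e) -> 0 <= e -> enorm x <= d%:R * e.
Proof.
move=> xe e0; rewrite -(@ler_sqr R) ?nnegrE ?enorm_ge0 ?mulr_ge0//.
rewrite sqr_enormE exprMn.
apply: (@le_trans _ _ (d%:R * e ^+ 2)).
  rewrite mulr_natl -[X in _ *+ X]card_ord -sumr_const; apply: ler_sum => i _.
  by rewrite -real_normK ?num_real// lerXn2r ?nnegrE.
rewrite ler_wpM2r ?sqr_ge0// -natrX ler_nat.
by case: d {x xe} => // n; rewrite leq_pmulr.
Qed.

Lemma coord_le_enorm {R : realType} {d : nat} (x : 'cV[R]_d) i :
  `|x i 0| <= enorm x.
Proof.
rewrite -(@ler_sqr R) ?nnegrE ?enorm_ge0// sqr_enormE real_normK ?num_real//.
by rewrite (bigD1 i)//= lerDl sumr_ge0// => j _; exact: sqr_ge0.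
Qed.

(** Only a solution is given, not the solution map, and [implicit_euler_stability]
    is enough to see that this solution depends continuously on the data. *)
Lemma measurable_implicit_euler {disp} {T : measurableType disp} {R : realType}
    {d : nat} (f : 'cV[R]_d -> 'cV[R]_d -> 'cV[R]_d) (D b : R)
    (x y z : T -> 'cV[R]_d) :
  0 <= D -> 0 <= b ->
  (forall u u' v v',
    2 * dotv (u - u') (f u v - f u' v') <= b * enorm (v - v') ^+ 2) ->
  measurable_mx y -> measurable_mx z ->
  (forall w, x w = z w + D *: f (x w) (y w)) ->
  measurable_mx x.
Proof.
move=> D0 b0 hf my mz xE i j; rewrite (ord1 j).
pose h (l : 'I_d + 'I_d) w := match l with inl a => z w a 0 | inr a => y w a 0 end.
apply: (@measurable_fun_continuous_dependence _ _ _ _ h).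
  by case=> a; [exact: mz|exact: my].
move=> w e e0; 
pose k1 : R := d%:R ^+ 2 * (1 + D * b) + 1.
have k10 : 1 <= k1 by rewrite lerDr mulr_ge0 ?sqr_ge0// addr_ge0// mulr_ge0.
have [r r0 eE] : exists2 r, 0 < r & e = r * (k1 + 1).
  have k11 : 0 < k1 + 1 by rewrite addr_gt0// (lt_le_trans ltr01).
  by exists (e / (k1 + 1)); rewrite ?divr_gt0// divfK ?gt_eqF.
exists r => // w' hw.
have zr : enorm (z w' - z w) <= d%:R * r.
  apply: enorm_le_coord; last exact: ltW.
  by move=> a; rewrite !mxE; exact: ltW (hw (inl a)).
have yr : enorm (y w' - y w) <= d%:R * r.
  apply: enorm_le_coord; last exact: ltW.
  by move=> a; rewrite !mxE; exact: ltW (hw (inr a)).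
have xr : enorm (x w' - x w) ^+ 2 <= k1 * r ^+ 2.
  apply: le_trans (implicit_euler_stability f D b _ _ _ _ _ _ D0
    (hf _ _ _ _) (xE w') (xE w)) _.
  have zr2 : enorm (z w' - z w) ^+ 2 <= (d%:R * r) ^+ 2.
    by rewrite lerXn2r ?nnegrE ?enorm_ge0// mulr_ge0// ltW.
  have yr2 : enorm (y w' - y w) ^+ 2 <= (d%:R * r) ^+ 2.
    by rewrite lerXn2r ?nnegrE ?enorm_ge0// mulr_ge0// ltW.
  move: (ler_wpM2l (mulr_ge0 D0 b0) yr2) zr2 (sqr_ge0 r); rewrite /k1 !exprMn.
  move: (enorm (z w' - z w) ^+ 2) (enorm (y w' - y w) ^+ 2).
  by move: (d%:R ^+ 2 : R) (r ^+ 2) => E F A B; clear; lra.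
have xi : `|x w' i 0 - x w i 0| <= enorm (x w' - x w).
  by have := coord_le_enorm (x w' - x w) i; rewrite !mxE.
apply: le_lt_trans xi _; rewrite -(@ltr_sqr R) ?nnegrE ?enorm_ge0 ?(ltW e0)//.
apply: le_lt_trans xr _.
rewrite eE exprMn mulrC ltr_pM2l ?exprn_gt0//.
clearbody k1; nra.
Qed.

Section grid_solution.
Context {R : realType} {disp : measure_display} {Omega : measurableType disp}.
Context (P : probability Omega R) (F : R -> set (set Omega)).
Hypothesis hF : filtration_usual P F.
Context {d m : nat} (W : R -> Omega -> 'cV[R]_m).
Hypothesis hW : brownian_motion P F W.
Context (f : 'cV[R]_d -> 'cV[R]_d -> 'cV[R]_d)
  (g : 'cV[R]_d -> 'cV[R]_d -> 'M[R]_(d, m)).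
Hypothesis hg : borel_fun (fun z : 'cV[R]_d * 'cV[R]_d => g z.1 z.2).
Context (D b2 : R) (M : nat) (Y : nat -> Omega -> 'cV[R]_d).
Hypotheses (M_gt0 : (0 < M)%N) (D0 : 0 < D) (b2_ge0 : 0 <= b2).
Hypothesis hf : forall u u' v v',
  2 * dotv (u - u') (f u v - f u' v') <= b2 * enorm (v - v') ^+ 2.
Hypothesis Y_past : forall j, (j <= M)%N -> forall w w', Y j w = Y j w'.
Hypothesis Y_step : forall n w,
  Y (n + M).+1 w = Y (n + M)%N w + D *: f (Y (n + M).+1 w) (Y n.+1 w)
    + g (Y (n + M)%N w) (Y n w) *m (W (n.+1%:R * D) w - W (n%:R * D) w).

Local Notation G n := (g_sigma_algebraType (F (n%:R * D))).

Lemma filtration_grid_mono n : F (n%:R * D) `<=` F (n.+1%:R * D).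
Proof.
apply: (filtration_mono hF); first by rewrite mulr_ge0// ltW.
by rewrite ler_pM2r// ler_nat.
Qed.

Lemma grid_solution_adapted n j : (j <= n + M)%N ->
  @measurable_mx _ (G n) R _ _ (Y j).
Proof.
elim: n j => [|n IH] j.
  rewrite add0n => jM a b.
  rewrite (_ : (fun w => _) = cst (Y j point a b)); first exact: measurable_cst.
  by apply/funext => w /=; rewrite (Y_past j jM w point).
have coarser (h : Omega -> R) : measurable_fun [set: G n] (h : G n -> R) ->
    measurable_fun [set: G n.+1] (h : G n.+1 -> R).
  by apply: measurable_fun_coarser; exact: filtration_grid_mono.
rewrite addSn leq_eqVlt ltnS => /predU1P[->|jn]; last first.
  by move=> a b; apply: coarser; exact: IH.
have mY i : (i <= n + M)%N -> @measurable_mx _ (G n.+1) R _ _ (Y i).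
  by move=> inM a b; apply: coarser; exact: IH.
have mWn : @measurable_mx _ (G n.+1) R _ _ (W (n%:R * D)).
  move=> a b; apply: coarser.
  by apply: (brownian_adapted_mx P F W hW); rewrite mulr_ge0// ltW.
have mWn1 : @measurable_mx _ (G n.+1) R _ _ (W (n.+1%:R * D)).
  by apply: (brownian_adapted_mx P F W hW); rewrite mulr_ge0// ltW.
have mz : @measurable_mx _ (G n.+1) R _ _ (fun w => Y (n + M)%N w +
    g (Y (n + M)%N w) (Y n w) *m (W (n.+1%:R * D) w - W (n%:R * D) w)).
  apply: measurable_mxD; first exact: mY.
  apply: measurable_mxM.
    by apply: measurable_mx_borel_comp => //; apply: mY; rewrite ?leq_addr.
  move=> a b; under eq_fun do rewrite !mxE.
  by apply: measurable_funB; [exact: mWn1|exact: mWn].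
apply: (@measurable_implicit_euler _ (G n.+1) R d f D b2 (Y (n + M).+1) (Y n.+1) _
  (ltW D0) b2_ge0 hf _ mz).
  by apply: mY; rewrite -addn1 leq_add2l.
by move=> w; rewrite {1}Y_step addrAC.
Qed.

Context (q b9 b10 b11 b12 b13 l2 lam C : R).
Hypothesis diss : forall x y,
    2 * dotv x (f x y) + l2 * trnorm (g x y) ^+ 2
      <= b9 - b10 * enorm x ^+ 2 + b11 * enorm y ^+ 2
            - b12 * enorm x `^ (q + 1) + b13 * enorm y `^ (q + 1).
Hypotheses (b9_ge0 : 0 <= b9) (b11_ge0 : 0 <= b11) (b13_ge0 : 0 <= b13).
Hypotheses (lam_gt0 : 0 < lam) (rhoC : (1 + lam * D) ^+ M <= C)
  (lamC : lam + C * b11 <= b10) (Cb : C * b13 <= b12) (rhol : 1 + lam * D <= l2).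

Local Notation U n w := (lyapunov g q b11 b13 D lam M (Y^~ w) n).

Lemma measurable_lyapunov n :
  measurable_fun [set: G n] ((fun w => U n w) : G n -> R).
Proof.
rewrite /lyapunov.
have mY j : (j <= n + M)%N -> @measurable_mx _ (G n) R _ _ (Y j).
  exact: grid_solution_adapted.
have mYn : @measurable_mx _ (G n) R _ _ (Y n) by apply: mY; rewrite leq_addr.
apply: measurable_funD; first apply: measurable_funD.
- by apply: measurable_sqr_enorm; exact: mY.
- apply: measurable_funM => //; apply: measurable_sqr_trnorm.
  by apply: measurable_mx_borel_comp => //; exact: mY.
- apply: measurable_funM => //; apply: measurable_sum => l.
  have mYl : @measurable_mx _ (G n) R _ _ (Y (n + l).+1).
    by apply: mY; rewrite -addnS leq_add2l.
  apply: measurable_funM => //; apply: measurable_funD.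
    by apply: measurable_funM => //; exact: measurable_sqr_enorm.
  apply: measurable_funM => //.
  apply: (measurableT_comp (measurable_powR (q + 1))).
  exact: measurable_enorm.
Qed.

Lemma integral_lyapunov_noise n :
  P.-integrable setT (fun w => (U n w)%:E) ->
  let N w := noise D (Y (n + M)%N w) (g (Y (n + M)%N w) (Y n w))
    (W (n.+1%:R * D) w - W (n%:R * D) w) in
  P.-integrable setT (fun w => (N w)%:E) /\
  forall A, F (n%:R * D) A -> (\int[P]_(w in A) (N w)%:E = 0)%E.
Proof.
move=> iU /=.
have n0 : 0 <= n%:R * D by rewrite mulr_ge0// ltW.
have nn1 : n%:R * D < n.+1%:R * D by rewrite ltr_pM2r// ltr_nat.
have DE : n.+1%:R * D - n%:R * D = D by rewrite -mulrBl -natrB// subSnn mul1r.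
have FM := filtration_measurable hF n0.
have mYM : @measurable_mx _ (G n) R _ _ (Y (n + M)%N) by exact: grid_solution_adapted.
have mYn : @measurable_mx _ (G n) R _ _ (Y n).
  by apply: grid_solution_adapted; rewrite leq_addr.
have mg : @measurable_mx _ (G n) R _ _ (fun w => g (Y (n + M)%N w) (Y n w)).
  exact: measurable_mx_borel_comp.
have lam0 := ltW lam_gt0; have D0' := ltW D0.
have := integral_noise P F hF W hW _ _ n0 nn1 (Y (n + M)%N)
  (fun w => g (Y (n + M)%N w) (Y n w)) mYM mg.
rewrite DE; apply.
- apply: (le_integrable measurableT _ _ iU).
    apply/measurable_EFinP; apply: (measurable_fun_sub_sigma _ _ FM).
    exact: measurable_sqr_enorm.
  move=> w _ /=; rewrite lee_fin !ger0_norm ?sqr_ge0//.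
    exact: le_lyapunov.
  exact: lyapunov_ge0.
- apply: (le_integrable measurableT _ _ (integrableZl measurableT D^-1 iU)).
    apply/measurable_EFinP; apply: (measurable_fun_sub_sigma _ _ FM).
    exact: measurable_sqr_trnorm.
  move=> w _ /=; rewrite lee_fin ger0_norm ?sqr_ge0//.
  apply: le_trans (ler_norm _); rewrite ler_pdivlMl//.
  exact: le_lyapunov_diffusion.
Qed.

Context (K : R).
Hypotheses (U0K : forall w, U 0 w <= K) (b9K : b9 <= lam * K).

Lemma grid_solution_maximal (k N : nat) (l : R) : 0 <= l ->
  (l%:E * P (~` [set w | forall j, (j <= N)%N -> (U (k + j) w <= l)%R]) <=
   (K + D * b9 *+ N)%:E)%E.
Proof.
have lam0 := ltW lam_gt0; have D0' := ltW D0.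
apply: (dissipative_maximal P (fun n => F (n%:R * D)) _ _ _ (fun n w => U n w)
  (fun n w => noise D (Y (n + M)%N w) (g (Y (n + M)%N w) (Y n w))
    (W (n.+1%:R * D) w - W (n%:R * D) w)) _ _ (1 + lam * D)) => //.
- by move=> n; apply: (filtration_sigma hF); rewrite mulr_ge0.
- by move=> n; apply: (filtration_measurable hF); rewrite mulr_ge0.
- by move=> n; exact: filtration_grid_mono.
- move=> n w.
  exact: lyapunov_ge0.
- exact: measurable_lyapunov.
- by rewrite lerDl mulr_ge0.
- by rewrite mulr_ge0.
- by rewrite addrC addKr -mulrA mulrCA ler_wpM2l.
- move=> n w.
  exact: (lyapunov_noise_step f g q b9 b10 b11 b12 b13 l2 diss b11_ge0 b13_ge0
    D lam C M D0' rhoC lamC Cb rhol (Y^~ w)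
    (fun n => W (n.+1%:R * D) w - W (n%:R * D) w) n (Y_step n w)).
- by move=> n iU; exact: integral_lyapunov_noise.
Qed.

End grid_solution.

(** * From the grid to the segment process *)

Lemma in_ball_enorm_le {R : realType} {d : nat} (tau r : R) (xi : R -> 'cV[R]_d) u :
  0 < tau -> in_ball tau r xi -> - tau <= u <= 0 -> enorm (xi u) <= r.
Proof.
move=> tau0 [cxi xir] utau; apply: le_trans xir.
have cn : {within `[- tau, 0], continuous (fun v => enorm (xi v))}.
  have ce : continuous (@enorm R d).
    move=> x; apply: (@continuous_comp _ _ _ (fun x => dotv x x) Num.sqrt).
      have cc (i : 'I_d) : xpredT i -> continuous (fun x : 'cV[R]_d => x i 0 * x i 0).
        have ci : continuous (fun x : 'cV[R]_d => x i 0).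
          by move=> y; exact: coord_continuous.
        by move=> _ y; exact: (continuousM (ci y) (ci y)).
      exact: (@continuous_big R 'I_d +%R 0 xpredT (@add_continuous _) 'cV[R]_d
        (index_enum _) _ cc).
    exact: sqrt_continuous.
  by move=> v; apply: continuous_comp; [exact: cxi|exact: ce].
apply: ub_le_sup; last by exists u => //=; rewrite in_itv.
have [|c _ hc] := EVT_max _ cn; first by rewrite oppr_le0 ltW.
by exists (enorm (xi c)) => _ [v /= v0 <-]; exact: hc.
Qed.

Lemma enorm_interpolation {R : realType} {d : nat} (a b : 'cV[R]_d) (th H : R) :
  0 <= th <= 1 -> enorm a <= H -> enorm b <= H ->
  enorm ((1 - th) *: a + th *: b) <= H.
Proof.
move=> /andP[th0 th1] aH bH; apply: le_trans (ler_enormD _ _) _.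
rewrite !enormZ !ger0_norm ?subr_ge0//.
have h1 : 0 <= 1 - th by rewrite subr_ge0.
have := ler_wpM2l h1 aH; have := ler_wpM2l th0 bH; lra.
Qed.

Section bem_path.
Context {R : realType} {d : nat} {Omega : Type} (tau : R) (tau0 : 0 < tau).
Context (M : nat) (M_gt0 : (0 < M)%N) (xi : R -> 'cV[R]_d) (rad : R).
Hypothesis xi_ball : in_ball tau rad xi.
Context (X : int -> Omega -> 'cV[R]_d).
Context (k : nat) (T : R) (T0 : 0 <= T).

Local Notation D := (stepsize tau M).
Local Notation Y j := (X (j%:Z - M%:Z)).
Local Notation path := (bem_path tau M xi X).

(** The grid point that ends the last interval met by [t_k, t_k + T], in the
    numbering where [Y M] is the value at time 0. *)
Definition last_index : nat := (Num.truncn ((k%:R * D + T) / D) + M).+1.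

Lemma stepsize_gt0 : 0 < D.
Proof. by rewrite divr_gt0// ltr0n. Qed.

Lemma stepsizeM : M%:R * D = tau.
Proof. by rewrite /stepsize mulrC divfK// pnatr_eq0 -lt0n. Qed.

Lemma bem_path_interpolation t : 0 < t -> k%:R * D - tau <= t <= k%:R * D + T ->
  exists i th, [/\ (k <= i)%N, (i < last_index)%N, 0 <= th <= 1 &
    forall w, path w t = (1 - th) *: Y i w + th *: Y i.+1 w].
Proof.
move=> t0 /andP[tk tT]; have D0 := stepsize_gt0.
have tD : 0 <= t / D by rewrite divr_ge0// ltW.
have [i iE] : exists i : nat, Num.floor (t / D) = i%:Z.
  by have := tD; rewrite -floor_ge0; case: (Num.floor _) => // i _; exists i.
have i1 : i%:R <= t / D by have := floor_le (t / D); rewrite iE.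
have i2 : t / D < i.+1%:R.
  by have := floorD1_gt (t / D); rewrite iE intrD -natr1.
exists (i + M)%N, (t / D - i%:R); split.
- rewrite -ltnS -addSn -(ltr_nat R) natrD.
  have : k%:R - M%:R <= t / D by rewrite ler_pdivlMr// mulrBl stepsizeM.
  lra.
- rewrite /last_index ltnS leq_add2r truncn_ge_nat.
    by apply: le_trans i1 _; rewrite ler_pM2r ?invr_gt0.
  by rewrite divr_ge0 ?addr_ge0 ?mulr_ge0// ltW.
- by rewrite subr_ge0 i1/= lerBlDr addrC natr1 ltW.
- move=> w; rewrite /bem_path leNgt t0/= iE.
  rewrite (_ : (i + M)%:Z - M%:Z = i%:Z); last by rewrite PoszD addrK.
  rewrite (_ : (i + M).+1%:Z - M%:Z = i%:Z + 1); last first.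
    by rewrite -addSn PoszD addrK -addn1 PoszD.
  have -> : (i%:Z)%:~R = i%:R :> R by [].
  move: (t / D - i%:R) => th.
  by rewrite scalerBl scale1r scalerBr addrA addrAC.
Qed.

Lemma bem_path_le w H : rad <= H ->
  (forall j, (k <= j <= last_index)%N -> enorm (Y j w) <= H) ->
  forall t, k%:R * D - tau <= t <= k%:R * D + T -> enorm (path w t) <= H.
Proof.
move=> radH YH t tk; have [t0|t0] := leP t 0.
  rewrite /bem_path t0; apply: le_trans radH.
  apply: (in_ball_enorm_le tau) => //; rewrite t0 andbT.
  case/andP: tk => tk _; apply: le_trans tk.
  by rewrite lerDr mulr_ge0// ltW// stepsize_gt0.
have [i [th [ki il th01 pE]]] := bem_path_interpolation t t0 tk.
rewrite pE; apply: enorm_interpolation => //; apply: YH.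
  by rewrite ki ltnW.
by rewrite il leqW.
Qed.

(** The times [s + u] with [s] in the window and [u] in the delay interval are
    those of the window enlarged by [tau] to the left; the converse takes
    [s = max t t_k]. *)
Lemma segment_event H : 0 <= H ->
  [set w | forall s, gridpt tau M k%:Z <= s <= gridpt tau M k%:Z + T ->
             supnorm tau (segment (path w) s) <= H] =
  [set w | forall t, k%:R * D - tau <= t <= k%:R * D + T -> enorm (path w t) <= H].
Proof.
move=> H0; have -> : gridpt tau M k%:Z = k%:R * D by [].
apply/seteqP; split=> w /= h; last first.
  move=> s /andP[sk sT]; apply: ge_sup.
    exists (enorm (segment (path w) s 0)), 0 => //=.
    by rewrite in_itv/= lexx oppr_le0 ltW.
  move=> _ [u /= + <-]; rewrite in_itv/= => /andP[u1 u2]; apply: h.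
  by apply/andP; split; lra.
move=> t /andP[tk tT].
pose s := Num.max t (k%:R * D).
have s1 : k%:R * D <= s by rewrite le_max lexx orbT.
have s2 : s <= k%:R * D + T by rewrite ge_max tT lerDl.
apply: le_trans (h s _); last by rewrite s1.
have sup_in u : - tau <= u <= 0 ->
    enorm (path w (s + u)) <= supnorm tau (segment (path w) s).
  move=> u0; apply: ub_le_sup; last by exists u.
  (* The supremum of an unbounded set would be 0, hence the need for a bound. *)
  pose B := \big[Num.max/Num.max rad 0]_(j < last_index.+1) enorm (Y j w).
  exists B => _ [v /= + <-]; rewrite in_itv/= => /andP[v1 v2].
  apply: bem_path_le.
  - by rewrite (le_trans _ (bigmax_ge_id _ _ _ _))// le_max lexx.
  - move=> j /andP[_ jl].
    exact: (le_bigmax _ (fun j : 'I_last_index.+1 => enorm (Y j w))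
      (Ordinal (jl : (j < last_index.+1)%N))).
  - by apply/andP; split; lra.
have -> : t = s + (t - s) by rewrite addrC subrK.
apply: sup_in; rewrite subr_le0 le_max lexx/= andbT.
have : s <= t + tau by rewrite ge_max lerDl (ltW tau0) -lerBlDr.
by rewrite lerNl opprB lerBlDr addrC.
Qed.

End bem_path.

(** If the path exceeds [H] at some time [t], it still does after a small
    perturbation of the two grid values around [t]. *)
Lemma measurable_path_event {R : realType} {disp} {Omega : measurableType disp}
    {d : nat} (tau : R) (tau0 : 0 < tau) (M : nat) (M_gt0 : (0 < M)%N)
    (xi : R -> 'cV[R]_d) (X : int -> Omega -> 'cV[R]_d) (k : nat) (T : R)
    (T0 : 0 <= T) (H : R) :
  (forall j : nat, measurable_mx (X (j%:Z - M%:Z))) ->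
  measurable [set w | forall t,
    k%:R * stepsize tau M - tau <= t <= k%:R * stepsize tau M + T ->
    enorm (bem_path tau M xi X w t) <= H].
Proof.
move=> mX; rewrite -[X in measurable X]setCK; apply: measurableC.
pose L := (last_index tau M k T).+1.
pose h (l : 'I_L * 'I_d) w := X (l.1%:Z - M%:Z) w l.2 0.
apply: (@measurable_open_dependence _ _ _ _ h) => [[j a]|w]; first exact: mX.
move=> /existsNP[t /not_implyP[tk /negP]]; rewrite -ltNge => wH.
have [t0|t0] := leP t 0.
  exists 1 => // w' _ /(_ t tk); apply/negP; rewrite -ltNge.
  by move: wH; rewrite /bem_path t0.
have [i [th [ki il th01 pE]]] :=
  bem_path_interpolation tau tau0 M M_gt0 xi X k T T0 t t0 tk.
pose e := (enorm (bem_path tau M xi X w t) - H) / (d%:R + 1).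
have e0 : 0 < e by rewrite divr_gt0 ?subr_gt0// ltr_wpDl.
exists e => // w' hw /(_ t tk); apply/negP; rewrite -ltNge.
have close j : (j < L)%N ->
    enorm (X (j%:Z - M%:Z) w - X (j%:Z - M%:Z) w') <= d%:R * e.
  move=> jL; apply: enorm_le_coord; last exact: ltW.
  by move=> a; rewrite !mxE distrC; exact: ltW (hw (Ordinal jL, a)).
have : enorm (bem_path tau M xi X w t) <= enorm (bem_path tau M xi X w' t) + d%:R * e.
  rewrite -[X in enorm X <= _](subrK (bem_path tau M xi X w' t)) addrC.
  apply: le_trans (ler_enormD _ _) _; rewrite lerD2l !pE.
  rewrite opprD addrACA -!scalerBr; apply: enorm_interpolation => //; apply: close.
    by rewrite /L ltnW// ltnS ltnW.
  by rewrite /L ltnS.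
have : e * (d%:R + 1) = enorm (bem_path tau M xi X w t) - H.
  by rewrite /e divfK// gt_eqF// ltr_wpDl.
clearbody e; move: (enorm _) (enorm _) => A B; nra.
Qed.

Theorem lemma4p5 (R : realType) (d m : nat)
    (disp : measure_display) (Omega : measurableType disp)
    (P : probability Omega R)
    (F : R -> set (set Omega)) (hF : filtration_usual P F)
    (W : R -> Omega -> 'cV[R]_m) (hW : brownian_motion P F W)
    (tau : R) (htau : 0 < tau)
    (f : 'cV[R]_d -> 'cV[R]_d -> 'cV[R]_d)
    (g : 'cV[R]_d -> 'cV[R]_d -> 'M[R]_(d, m))
    (hf : borel_fun (fun z : 'cV[R]_d * 'cV[R]_d => f z.1 z.2))
    (hg : borel_fun (fun z : 'cV[R]_d * 'cV[R]_d => g z.1 z.2))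
    (q a1 a2 a3 a4 a5 a6 a7 a8 a9 eps1 eps2 : R)
    (g1 g2 : 'cV[R]_d -> 'M[R]_(d, m))
    (hreg : regularity f g q a1 a2 a3 a4 a5 a6 a7 a8 a9 eps1 eps2 g1 g2)
    (b1 b2 b3 b4 b5 b6 b7 b8 b9 b10 b11 b12 b13 l1 l2 : R)
    (hdiss : dissipativity f g q a2 a3 a4 a5
               b1 b2 b3 b4 b5 b6 b7 b8 b9 b10 b11 b12 b13 l1 l2)
    (rad : R) (hrad : 0 < rad)
    (T : R) (hT : 0 <= T) (eps7 : R) (heps7 : 0 < eps7) :
  exists2 H : R, 0 < H &
    forall (M : nat) (k : nat) (xi : R -> 'cV[R]_d)
        (X : int -> Omega -> 'cV[R]_d),
      (0 < M)%N -> in_ball tau rad xi -> bem_scheme tau f g W M xi X ->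
      ((1 - eps7)%:E <=
        P [set w | forall s : R,
             (gridpt tau M k%:Z <= s <= gridpt tau M k%:Z + T)%R ->
             (supnorm tau (segment (bem_path tau M xi X w) s) <= H)%R])%E.
Proof.
have [[b1_0 b2_0 b3_0 _ _] [[_ _ _ b9_0 _] [b11_0 _ b13_0]]] := diss_b hdiss.
have [_ [a7_0 a8_0 a9_0]] := reg_a hreg.
have q0 : 0 <= q by apply: le_trans (reg_q hreg).
have [_ l2_1] := diss_l hdiss.
have [lam [C [lam0 lamC Cb laml powC]]] := discount_rate tau b10 b11 b12 b13 l2
  htau b11_0 b13_0 (diss_b10 hdiss) (diss_b12 hdiss) l2_1.
pose K := Num.max (lyapunov_bound q b11 b13 C a7 a8 a9 rad tau) (b9 / lam).
have K0 : 0 <= K by rewrite le_max divr_ge0 ?orbT// ltW.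
pose Q := K + b9 * (T + 2 * tau).
have Q0 : 0 <= Q by rewrite addr_ge0// mulr_ge0// addr_ge0// mulr_ge0// ltW.
(* [H >= 1] turns [H >= Q / eps7] into the required [H ^+ 2 >= Q / eps7]. *)
pose H := rad + 1 + Q / eps7.
have Qe : 0 <= Q / eps7 by rewrite divr_ge0// ltW.
have H1 : 1 <= H by rewrite /H -addrA addrCA lerDl addr_ge0// ltW.
have H0 : 0 <= H by rewrite (le_trans ler01).
have radH : rad <= H by rewrite /H -addrA lerDl addr_ge0.
have QH : Q <= H ^+ 2 * eps7.
  rewrite -ler_pdivrMr//; apply: (@le_trans _ _ H).
    by rewrite /H lerDr addr_ge0// ltW.
  by rewrite expr2 ler_peMl.
exists H; first by rewrite (lt_le_trans ltr01).
move=> M k xi X M0 xi_ball scheme.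
have D0 : 0 < stepsize tau M by exact: stepsize_gt0.
have MD := stepsizeM tau M M0.
set D := stepsize tau M in D0 MD.
(* Shifting the index by [M] makes it a natural number. *)
pose Y (j : nat) := X (j%:Z - M%:Z).
have YD j : (j <= M)%N -> forall w, Y j w = xi (gridpt tau M (j%:Z - M%:Z)).
  move=> jM w; apply: (bem_init scheme); apply/andP; split.
    by rewrite lerDr.
  by rewrite subr_le0 lez_nat.
have Y_rad j w : (j <= M)%N -> enorm (Y j w) <= rad.
  move=> jM; rewrite YD//; apply: (in_ball_enorm_le tau) => //.
  rewrite /gridpt -/D intrD rmorphN/= mulrDl mulNr MD; apply/andP; split.
    by rewrite lerDr mulr_ge0// ltW.
  by rewrite subr_le0 -MD ler_pM2r// ler_nat.
have Y_step n w : Y (n + M).+1 w = Y (n + M)%N w + D *: f (Y (n + M).+1 w) (Y n.+1 w)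
    + g (Y (n + M)%N w) (Y n w) *m (W (n.+1%:R * D) w - W (n%:R * D) w).
  have YX j : Y (j + M)%N = X j%:Z by rewrite /Y PoszD addrK.
  have := bem_step scheme (k := n.+1%:Z) w.
  rewrite -addSn !YX /gridpt -/D.
  have -> : n.+1%:Z - 1 = n%:Z by rewrite -addn1 PoszD addrK.
  have -> : n.+1%:Z - M%:Z - 1 = n%:Z - M%:Z by rewrite addrAC -addn1 PoszD addrK.
  by apply.
have hf2 u u' v v' : 2 * dotv (u - u') (f u v - f u' v') <= b2 * enorm (v - v') ^+ 2.
  apply: le_trans (diss_diff hdiss u u' v v') _.
  have V0 : 0 <= V q u u' by rewrite mulr_ge0 ?sqr_ge0// addr_ge0 ?powR_ge0.
  have := mulr_ge0 b3_0 V0; have := mulr_ge0 b1_0 (sqr_ge0 (enorm (u - u'))); lra.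
have Y_past j : (j <= M)%N -> forall w w', Y j w = Y j w'.
  by move=> jM w w'; rewrite !YD.
have Y_adapted := grid_solution_adapted P F hF W hW f g hg D b2 M Y M0 D0 b2_0
  hf2 Y_past Y_step.
have mY j : measurable_mx (Y j).
  move=> a b; have j0 : 0 <= j%:R * D by rewrite mulr_ge0// ltW.
  exact: (measurable_fun_sub_sigma _ _ (filtration_measurable hF j0)
    (Y_adapted j j (leq_addr _ _) a b)).
rewrite (segment_event tau htau M M0 xi rad xi_ball X k T hT H H0).
set S := [set w | _].
have mS : measurable S by exact: measurable_path_event.
pose n := Num.truncn ((k%:R * D + T) / D).
have kD0 : 0 <= k%:R * D + T by rewrite addr_ge0// mulr_ge0// ltW.
have nD : n%:R * D <= k%:R * D + T.
  by rewrite -ler_pdivlMr// truncn_le// divr_ge0// ltW.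
have kn : (k <= n)%N.
  rewrite /n truncn_ge_nat; first by rewrite ler_pdivlMr// lerDl.
  by rewrite divr_ge0// ltW.
(* If [k <= M] the window reaches into the initial segment, and the process
   starts at time 0; truncated subtraction covers both cases. *)
pose N := (n.+1 - (k - M))%N.
have ND : N%:R * D <= T + 2 * tau.
  have k0n : (k - M <= n.+1)%N.
    by rewrite leq_subLR (leq_trans kn)// -addSnnS leq_addl.
  have kM : k%:R - M%:R <= (k - M)%N%:R :> R.
    by rewrite lerBlDr -natrD ler_nat addnC -leq_subLR.
  have DM : D <= M%:R * D by rewrite ler_peMl ?(ltW D0)// ler1n.
  have := ler_wpM2r (ltW D0) kM.
  rewrite /N (natrB _ k0n) -natr1; move: nD DM; rewrite -MD; lra.
pose U i w := lyapunov g q b11 b13 D lam M (Y^~ w) i.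
pose B := [set w | forall j, (j <= N)%N -> U (k - M + j)%N w <= H ^+ 2].
have mU i : measurable_fun setT (U i).
  have i0 : 0 <= i%:R * D by rewrite mulr_ge0// ltW.
  apply: (measurable_fun_sub_sigma _ _ (filtration_measurable hF i0)).
  exact: (measurable_lyapunov P F hF W hW f g hg D b2 M Y M0 D0 b2_0 hf2
    Y_past Y_step).
have mB : measurable B.
  rewrite (_ : B = \bigcap_(j in [set j | (j <= N)%N])
    (U (k - M + j)%N @^-1` `]-oo, H ^+ 2])); last first.
    by apply/seteqP; split => w h j /h /=; rewrite in_itv.
  apply: bigcap_measurable => [|j _]; first by exists 0%N.
  by rewrite -[X in measurable X]setTI; exact: mU.
have D0' := ltW D0; have lam0' := ltW lam0.
have BS : B `<=` S.
  move=> w Bw t.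
  apply: (bem_path_le tau htau M M0 xi rad xi_ball X k T hT w H radH) => j.
  move=> /andP[kj jl].
  have [jM|Mj] := leqP j M; first exact: le_trans (Y_rad j w jM) radH.
  rewrite -(@ler_sqr R) ?nnegrE ?enorm_ge0//.
  have jE : j = (k - M + (j - M - (k - M)) + M)%N.
    by rewrite subnKC ?leq_sub2r// subnK// ltnW.
  have /Bw : (j - M - (k - M) <= N)%N.
    by rewrite /N leq_sub2r// leq_subLR addnS addnC.
  apply: le_trans.
  rewrite [in leLHS]jE.
  exact: (le_lyapunov g q b11 b13 b11_0 b13_0 D lam M D0' lam0' (Y^~ w)).
have U0K w : U 0%N w <= K.
  apply: (@le_trans _ _ (lyapunov_bound q b11 b13 C a7 a8 a9 rad tau)); last first.
    by rewrite le_max lexx.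
  apply: (lyapunov0_le g q b11 b13 b11_0 b13_0 D lam C M) => //.
  - exact: powC.
  - exact: (reg_g_growth hreg).
  - exact: ltW.
  - by move=> j; exact: Y_rad.
have b9K : b9 <= lam * K.
  by rewrite mulrC -ler_pdivrMr// le_max lexx orbT.
have Dtau : D <= tau by rewrite -MD ler_peMl// ler1n.
have rhol : 1 + lam * D <= l2.
  by apply: le_trans laml; rewrite lerD2l ler_wpM2l.
have := grid_solution_maximal P F hF W hW f g hg D b2 M Y M0 D0 b2_0 hf2 Y_past Y_step
  q b9 b10 b11 b12 b13 l2 lam C (diss_growth hdiss) b9_0 b11_0 b13_0 lam0 (powC M M0)
  lamC Cb rhol K U0K b9K (k - M)%N N (H ^+ 2) (sqr_ge0 _).
rewrite -[X in P (~` X)]/B => hB.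
apply: (@le_trans _ _ (P B)); last by apply: le_measure => //; rewrite inE.
have : (P (~` B) <= eps7%:E)%E.
  rewrite -(@lee_pmul2l _ (H ^+ 2)%:E)//; last first.
    by rewrite lte_fin exprn_gt0// (lt_le_trans ltr01).
  apply: le_trans hB _; rewrite -EFinM lee_fin; apply: le_trans QH.
  by rewrite /Q lerD2l -mulr_natl mulrA [leRHS]mulrC ler_wpM2r.
rewrite probability_setC// => PB; rewrite EFinB leeBlDr//.
by rewrite addeC -leeBlDr// fin_num_measure.
Qed.
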